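(* Let $d\geq 3$ and let $G$ be a connected $d$-regular graph. (i) Let $d=3$. If $\lambda_2(G)\leq \lambda_2(G_{3,1})$ and $G$ is not isomorphic to $G_{3,1}=K_2\vee\overline{M_{2}}\vee K_1\vee K_1\vee\overline{M_{2}}\vee K_2$, then $\kappa(G)\geq 2$. (ii) Let $d\geq 4$ be even and $c=2\lfloor d/4\rfloor$. If $\lambda_2(G)\leq \lambda_2(G_{d,c})$ and $G$ is not isomorphic to $$G_{d,c}=K_{2\lfloor\frac{d+2}{4}\rfloor+1}\vee\overline{M_{2\lfloor\frac{d}{4}\rfloor}}\vee K_1\vee \overline{M_{2\lfloor\frac{d+2}{4}\rfloor}}\vee K_{2\lfloor\frac{d}{4}\rfloor+1},$$ then $\kappa(G)\geq 2$. (iii) Let $d\geq 5$ be odd. (a) If $\frac{d-1}{2}$ is odd, $\lambda_2(G)\leq\lambda_2(G_{d,\frac{d-1}{2}})$, and $G$ is not isomorphic to any graph of the form $\overline{M_{\frac{d+5}{2}}}\vee\overline{\mathcal C_{\frac{d-1}{2}}}\vee K_1\vee\overline{M_{\frac{d+1}{2}}}\vee K_{\frac{d+1}{2}}$, then $\kappa(G)\geq 2$. (b) If $\frac{d-1}{2}$ is even, $\lambda_2(G)\leq\lambda_2(G_{d,\frac{d-1}{2}})$, and $G$ is not isomorphic to any graph of the form $K_{\frac{d+3}{2}}\vee\overline{M_{\frac{d-1}{2}}}\vee K_1\vee\overline{\mathcal C_{\frac{d+1}{2}}}\vee\overline{M_{\frac{d+3}{2}}}$, then $\kappa(G)\geq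 2$.
   Context: All graphs are finite and simple. $\lambda_2(G)$ is the second largest eigenvalue of the adjacency matrix of $G$, and $\kappa(G)$ its vertex-connectivity. $K_n$ is the complete graph on $n$ vertices; for even $n$, $M_n$ is a perfect matching on $n$ vertices ($n/2$ disjoint edges); $\overline{H}$ is the complement of $H$ (so $\overline{M_n}$ is $K_n$ minus a perfect matching). For an integer $c\geq 3$, $\mathcal C_c$ denotes any disjoint union of cycles $C_{c_1}\cup\cdots\cup C_{c_s}$ with $c_1+\cdots+c_s=c$. The sequential join $G_1\vee\cdots\vee G_k$ is obtained from disjoint copies of $G_1,\dots,G_k$ by joining every vertex of $G_i$ to every vertex of $G_{i+1}$ for $1\leq i\leq k-1$. For odd $d\geq 3$ and $1\leq c\leq d-1$: $G_{d,c}=K_2\vee\overline{M_{d-1}}\vee K_1\vee K_1\vee\overline{M_{d-1}}\vee K_2$ if $c\in\{1,d-1\}$; $G_{d,c}=\overline{M_{d+2-c}}\vee\overline{\mathcal C_c}\vee K_1\vee\overline{M_{d-c}}\vee K_{c+1}$ if $c$ is odd with $2<c\leq d-2$; $G_{d,c}=K_{d+1-c}\vee\overline{M_c}\vee K_1\vee\overline{\mathcal C_{d-c}}\vee\overline{M_{c+2}}$ if $c$ is even with $2\leq c<d-2$. For even $d\geq 4$ and even $c\in[2,d-2]$: $G_{d,c}=K_{d+1-c}\vee\overline{M_c}\vee K_1\vee\overline{M_{d-c}}\vee K_{c+1}$. (When $G_{d,c}$ involves a choice of $\mathcal C$, $\lambda_2(G_{d,c})$ refers to any graph so obtained; its value does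 not depend on the choice.) *)

(* Defs.v *)
From HB Require Import structures.
From mathcomp Require Import all_boot all_order all_algebra.
From mathcomp Require Import polyrcf reals.

Set Implicit Arguments.
Unset Strict Implicit.
Unset Printing Implicit Defensive.

Import Order.TTheory GRing.Theory Num.Theory.

Record sgraph := SGraph {
  vertex :> finType;
  adj : rel vertex;
  adj_sym : symmetric adj;
  adj_irr : irreflexive adj }.

Arguments adj {s} x y.

Definition iso (G H : sgraph) : Prop :=
  exists2 f : G -> H, bijective f & forall x y, adj (f x) (f y) = adj x y.

Definition regular (d : nat) (G : sgraph) : Prop :=
  forall x : G, #|[set y | adj x y]| = d.

(* The graph with no vertices is not connected. *)
Definition connected (G : sgraph) : bool :=
  (0 < #|G|) && [forall x : G, forall y : G, connect adj x y].

Section Delete.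
Variables (G : sgraph) (S : {set G}).
Let V : finType := {x : G | x \notin S}.
Definition delete_adj : rel V := fun x y => adj (val x) (val y).
Fact delete_sym : symmetric delete_adj.
Proof. by move=> x y; apply: adj_sym. Qed.
Fact delete_irr : irreflexive delete_adj.
Proof. by move=> x; apply: adj_irr. Qed.
Definition delete := SGraph delete_sym delete_irr.
End Delete.

(* Deleting S disconnects G or leaves at most one vertex, so that
   kappa K_n = n - 1. *)
Definition separating (G : sgraph) (S : {set G}) : bool :=
  (#|delete S| <= 1) || ~~ connected (delete S).

(* The full vertex set is separating, so the minimum is over a nonempty
   family. *)
Definition kappa (G : sgraph) : nat :=
  #|[arg min_(S < [set: G] | separating S) #|S|]|.

Definition adjmx (R : realType) (G : sgraph) : 'M[R]_#|G| :=
  \matrix_(i, j) (adj (enum_val i) (enum_val j))%:R%R.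

(* The real eigenvalues in nonincreasing order, each repeated according to its
   multiplicity as a root of the characteristic polynomial. *)
Definition eigenvalues (R : realType) n (A : 'M[R]_n) : seq R :=
  sort >=%R (flatten
    [seq nseq (mup x (char_poly A)) x | x <- rootsR (char_poly A)]).

Definition lambda2 (R : realType) (G : sgraph) : R :=
  nth 0%R (eigenvalues (adjmx R G)) 1.

Section Complete.
Variable n : nat.
Definition complete_adj : rel 'I_n := fun x y => x != y.
Fact complete_sym : symmetric complete_adj.
Proof. by move=> x y; rewrite /complete_adj eq_sym. Qed.
Fact complete_irr : irreflexive complete_adj.
Proof. by move=> x; rewrite /complete_adj eqxx. Qed.
Definition complete := SGraph complete_sym complete_irr.
End Complete.

(* The edges are {0,1}, {2,3}, ...; a perfect matching when n is even. *)
Section Matching.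
Variable n : nat.
Definition matching_adj : rel 'I_n := fun x y => (x != y) && (x./2 == y./2).
Fact matching_sym : symmetric matching_adj.
Proof. by move=> x y; rewrite /matching_adj eq_sym [_./2 == _]eq_sym. Qed.
Fact matching_irr : irreflexive matching_adj.
Proof. by move=> x; rewrite /matching_adj eqxx. Qed.
Definition matching := SGraph matching_sym matching_irr.
End Matching.

(* The cycle C_n when n >= 3. *)
Section Cycle.
Variable n : nat.
Definition cycle_adj : rel 'I_n :=
  fun x y => (x != y) && ((y == ordS x) || (x == ordS y)).
Fact cycle_sym : symmetric cycle_adj.
Proof. by move=> x y; rewrite /cycle_adj eq_sym orbC. Qed.
Fact cycle_irr : irreflexive cycle_adj.
Proof. by move=> x; rewrite /cycle_adj eqxx. Qed.
Definition cycle_graph := SGraph cycle_sym cycle_irr.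
End Cycle.

Section Complement.
Variable G : sgraph.
Definition compl_adj : rel G := fun x y => (x != y) && ~~ adj x y.
Fact compl_sym : symmetric compl_adj.
Proof. by move=> x y; rewrite /compl_adj eq_sym adj_sym. Qed.
Fact compl_irr : irreflexive compl_adj.
Proof. by move=> x; rewrite /compl_adj eqxx. Qed.
Definition compl := SGraph compl_sym compl_irr.
End Complement.

Section DisjointUnion.
Variables G H : sgraph.
Definition dunion_adj : rel (G + H)%type := fun u v =>
  match u, v with
  | inl x, inl y => adj x y
  | inr x, inr y => adj x y
  | _, _ => false
  end.
Fact dunion_sym : symmetric dunion_adj.
Proof. by case=> x [] y //=; apply: adj_sym. Qed.
Fact dunion_irr : irreflexive dunion_adj.
Proof. by case=> x /=; apply: adj_irr. Qed.
Definition dunion := SGraph dunion_sym dunion_irr.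
End DisjointUnion.

Definition cycles_graph (s : seq nat) : sgraph :=
  foldr (fun k => dunion (cycle_graph k)) (complete 0) s.

Definition is_cycle_union (c : nat) (C : sgraph) : Prop :=
  exists s : seq nat, [/\ all (leq 3) s, sumn s = c & C = cycles_graph s].

(* A vertex of the join of [:: G_0; ...; G_(k-1)] is a pair (i, x), x in G_i. *)
Section SequentialJoin.
Variable s : seq sgraph.
Let V : finType := {i : 'I_(size s) & nth (complete 0) s i}.
Definition seqjoin_adj : rel V := fun u v =>
  if tag u == tag v then adj (tagged u) (tagged_as u v)
  else ((tag u).+1 == tag v) || ((tag v).+1 == tag u).
Fact seqjoin_sym : symmetric seqjoin_adj.
Proof.
move=> [i x] [j y]; rewrite /seqjoin_adj /= [j == i]eq_sym.
case: eqVneq y => [<- y|_ y]; first by rewrite !tagged_asE adj_sym.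
by rewrite orbC.
Qed.
Fact seqjoin_irr : irreflexive seqjoin_adj.
Proof. by move=> [i x]; rewrite /seqjoin_adj /= eqxx tagged_asE adj_irr. Qed.
Definition seqjoin := SGraph seqjoin_sym seqjoin_irr.
End SequentialJoin.

(* is_Gdc d c H: H is one of the graphs denoted G_{d,c}; there may be several,
   according to the choice of the disjoint union of cycles C. *)
Variant is_Gdc (d c : nat) : sgraph -> Prop :=
| Gdc_odd_end of odd d & 3 <= d & (c == 1) || (c == d - 1) :
    is_Gdc d c (seqjoin [:: complete 2; compl (matching (d - 1)); complete 1;
                            complete 1; compl (matching (d - 1)); complete 2])
| Gdc_odd_odd C of odd d & 3 <= d & odd c & 2 < c <= d - 2
                 & is_cycle_union c C :
    is_Gdc d c (seqjoin [:: compl (matching (d + 2 - c)); compl C; complete 1;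
                            compl (matching (d - c)); complete (c + 1)])
| Gdc_odd_even C of odd d & 3 <= d & ~~ odd c & 2 <= c < d - 2
                  & is_cycle_union (d - c) C :
    is_Gdc d c (seqjoin [:: complete (d + 1 - c); compl (matching c);
                            complete 1; compl C; compl (matching (c + 2))])
| Gdc_even_even of ~~ odd d & 4 <= d & ~~ odd c & 2 <= c <= d - 2 :
    is_Gdc d c (seqjoin [:: complete (d + 1 - c); compl (matching c);
                            complete 1; compl (matching (d - c));
                            complete (c + 1)]).

(* Main.v *)
(** A regular graph [G] with [kappa G < 2] has a cut vertex [v]; write [A] and [B] for
    the two sides, [c] and [e = d - c] for the numbers of neighbours of [v] in them.
    Counting degrees gives [#|A|, #|B| >= d + 1], and [>= d + 2] on the side with an odd
    number of neighbours of [v] when [d] is odd.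

    Take the cells [A \ N(v)], [A :&: N(v)], [v], [B :&: N(v)], [B \ N(v)], with the sides
    of minimal size and consecutive cells completely joined. The spectral gap [mu] of this
    weighted path solves [gap_poly _ _ d (c * e) mu = 0] and increases with [c * e], so it
    is largest for the most balanced admissible [c]. Its eigenvector [f], used as a test
    function on [G], satisfies [sum f (lap f - mu f) <= 0] over its positive and over its
    negative part; rescaling the two parts to make [f] orthogonal to the constants gives
    [lambda2 G >= d - mu]. Equality forces minimal sides and complete joins, hence the
    structure of [G]: co-regularity of degree 0, 1, 2 inside a cell means a complete graph,
    the complement of a perfect matching, of a union of cycles.

    Conversely [lambda2 <= d - mu] for the extremal graphs: functions summing to zero on
    each cell have energy at least their square norm, and on cell-wise constant functions
    the monotone eigenvector of the path minimises the Rayleigh quotient.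

    For [d = 3] a cut vertex yields a bridge, and the same argument is run with the
    six cells around the bridge. *)

Require Import Defs.
From mathcomp Require Import all_boot all_order all_algebra.
From mathcomp Require Import polyrcf complex reals.
From mathcomp Require Import ring lra zify.

Set Implicit Arguments.
Unset Strict Implicit.
Unset Printing Implicit Defensive.

Import Order.TTheory GRing.Theory Num.Theory.

(** * The second eigenvalue of a symmetric matrix *)

Section SecondEigenvalue.
Local Open Scope ring_scope.
Local Open Scope sesquilinear_scope.
Variables (R : realType) (n : nat).
Implicit Types (A : 'M[R]_n) (u h : 'rV[R]_n).
Local Notation toC := (real_complex R).
Local Notation cmx := (map_mx toC).

(** In a split monic polynomial the multiplicity of a root is its number of occurrences in [s]. This
    identifies the list sorted by [eigenvalues] once the characteristic polynomial is factored. *)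
Lemma perm_eq_roots (p : {poly R}) (s : seq R) :
  p = \prod_(x <- s) ('X - x%:P) ->
  perm_eq (flatten [seq nseq (mup x p) x | x <- rootsR p]) s.
Proof.
move=> pE; have p0 : p != 0.
  by rewrite pE monic_neq0 // monic_prod // => x _; apply: monicXsubC.
have mupE x : mup x p = count_mem x s.
  rewrite pE; elim: s {pE} => [|y s IH] /=.
    by rewrite big_nil mupNroot // root1.
  rewrite big_cons mupM ?polyXsubC_eq0 ?IH //; last first.
    by rewrite monic_neq0 // monic_prod // => z _; apply: monicXsubC.
  by rewrite -['X - y%:P]expr1 mup_XsubCX; case: (y == x).
have rootE x : (x \in rootsR p) = (x \in s).
  have := roots_on_rootsR p0 x; rewrite inE /= => <-.
  by rewrite [X in root X]pE root_prod_XsubC.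
apply/allP => x _ /=; apply/eqP.
rewrite count_flatten -map_comp.
transitivity (sumn [seq (if y == x then count_mem x s else 0)%N | y <- rootsR p]).
  congr sumn; apply: eq_map => y /=; rewrite count_nseq mupE /=.
  by case: eqP => [->|]; rewrite ?mul1n ?mul0n.
rewrite sumnE big_map -big_mkcond /= -big_filter.
have [xs|xs] := boolP (x \in s).
  rewrite filter_pred1_uniq ?big_seq1 //; first exact: uniq_roots.
  by rewrite rootE.
rewrite big1_seq => [|y]; first by rewrite (count_memPn xs).
by rewrite mem_filter => /andP[_ /andP[/eqP-> ]]; rewrite rootE (negPf xs).
Qed.

(** A real symmetric matrix is Hermitian over [R[i]], where the spectral theorem gives a unitary [P]
    and a real diagonal. Only the eigenvalues are brought back to [R], through the characteristic
    polynomial, which unitary conjugation preserves. *)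
Lemma symmetric_spectral A : A^T = A ->
  exists (r : 'I_n -> R) (P : 'M[R[i]]_n),
   [/\ P *m P^t* = 1%:M, P^t* *m P = 1%:M,
       (cmx A) = P^t* *m diag_mx (\row_j toC (r j)) *m P
     & perm_eq (eigenvalues A) [seq r j | j : 'I_n]].
Proof.
move=> Asym.
have herm : (cmx A) \is hermsymmx.
  apply: realsym_hermsym.
    by apply/is_hermitianmxP; rewrite expr0 scale1r; apply/matrixP => i j; rewrite !mxE /= -[in RHS]Asym mxE.
  by apply/mxOverP => i j; rewrite mxE; apply/complex_realP; exists (A i j).
have /orthomx_spectralP AE := hermitian_normalmx herm.
have Du := hermitian_spectral_diag_real herm.
have Pu := spectral_unitarymx (cmx A); set P := spectralmx (cmx A) in AE Pu.
have PPs : P *m P^t* = 1%:M by apply/unitarymxP.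
have PsP : P^t* *m P = 1%:M by apply: mulmx1C.
pose r j := complex.Re (spectral_diag (cmx A) 0 j).
have rE : spectral_diag (cmx A) = \row_j toC (r j).
  apply/rowP => j; rewrite !mxE /r RRe_real //.
  by move/mxOverP: Du; apply.
rewrite rE invmx_unitary // in AE.
exists r, P; split => //.
rewrite /eigenvalues perm_sort.
apply: perm_eq_roots; rewrite big_map.
apply: (@map_poly_inj _ _ toC); rewrite map_char_poly [in LHS]AE.
have -> : char_poly (P^t* *m diag_mx (\row_j toC (r j)) *m P) =
          char_poly (diag_mx (\row_j toC (r j))).
  rewrite /char_poly.
  set B := diag_mx _.
  have -> : char_poly_mx (P^t* *m B *m P) =
      map_mx polyC (P^t*) *m char_poly_mx B *m map_mx polyC P.
    rewrite /char_poly_mx mulmxBr mulmxBl -!map_mxM /=; congr (_ - _).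
    by rewrite scalar_mxC -mulmxA -map_mxM PsP map_mx1 mulmx1.
  rewrite !det_mulmx mulrAC -det_mulmx -map_mxM PsP map_mx1 det1 mul1r //.
rewrite char_poly_trig; last by apply/is_trig_mxP => i j ij; rewrite !mxE -val_eqE /= ltn_eqF ?mulr0n.
rewrite rmorph_prod big_enum /=; apply: eq_bigr => i _.
by rewrite !mxE eqxx mulr1n rmorphB /= map_polyX map_polyC.
Qed.

Lemma sorted_second_lt (s : seq R) (t : R) :
  sorted >=%R s -> (1 < size s)%N -> nth 0 s 1 < t ->
  (count (fun x => t <= x)%R s <= 1)%N.
Proof.
case: s => [|a [|b s]] //= /andP[_ sP] _ bt.
rewrite (leNgt t b) bt /= add0n.
suff -> : count (fun x => t <= x) s = 0%N by rewrite addn0 leq_b1.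
apply/eqP; rewrite -leqn0 leqNgt -has_count; apply/hasPn => x xs.
rewrite -ltNge; apply: le_lt_trans bt.
have /allP := order_path_min (rev_trans le_trans) sP; exact.
Qed.

Lemma sorted_second_gt (s : seq R) (t : R) :
  sorted >=%R s -> (1 < size s)%N -> t < nth 0 s 1 ->
  (2 <= count (fun x => t < x)%R s)%N.
Proof.
case: s => [|a [|b s]] //= /andP[ba _] _ tb.
by rewrite tb (lt_le_trans tb ba) addnA leq_addr.
Qed.

Lemma size_eigenvalues A : A^T = A -> size (eigenvalues A) = n.
Proof.
move=> /symmetric_spectral[r [P [_ _ _ /perm_size ->]]].
by rewrite size_map size_enum_ord.
Qed.

Lemma sorted_eigenvalues A : sorted >=%R (eigenvalues A).
Proof. exact: sort_sorted (fun x y => le_total y x) _. Qed.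

(** If the conclusion failed, at most one spectral coordinate would carry an eigenvalue [>= t]. As
    [t <= d], the eigenvector [u] lives on that coordinate, so [h], orthogonal to [u], vanishes
    there and its Rayleigh quotient is [< t]. *)
Lemma second_eigenvalue_ge A u h (t d : R) : (1 < n)%N -> A^T = A ->
  u != 0 -> u *m A = d *: u -> u *m h^T = 0 -> t <= d ->
  0 < (h *m h^T) 0 0 -> t * (h *m h^T) 0 0 <= (h *m A *m h^T) 0 0 ->
  t <= nth 0 (eigenvalues A) 1.
Proof.
move=> n1 Asym u0 uA uh td hh hAh; rewrite leNgt; apply/negP => ltt.
have [r [P [PPs PsP AE /permP rP]]] := symmetric_spectral Asym.
have /(_ _) := sorted_second_lt (sorted_eigenvalues A) _ ltt.
rewrite size_eigenvalues // => /(_ n1).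
rewrite rP count_map /= => cnt.
have card1 i j : t <= r i -> t <= r j -> i = j.
  move=> ti tj; apply/eqP; move: cnt; apply: contraLR => nij.
  rewrite -ltnNge -size_filter.
  apply: (@uniq_leq_size _ [:: i; j]); first by rewrite /= inE nij.
  by move=> k; rewrite !inE mem_filter mem_enum andbT /= => /orP[] /eqP->.
pose co (g : 'rV[R]_n) := cmx g *m P^t*.
have coA g : co (g *m A) = co g *m diag_mx (\row_j toC (r j)).
  by rewrite /co map_mxM AE !mulmxA -[LHS]mulmxA PPs mulmx1.
have parseval g k : co g *m (co k)^t* = cmx (g *m k^T).
  rewrite /co trmx_mul map_mxM trmxCK mulmxA -(mulmxA _ _ P) PsP mulmx1 map_mxM.
  congr (_ *m _); apply/matrixP => i j; rewrite !mxE; exact: conjc_real.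
have co0 g : co g = 0 -> g = 0.
  move=> /(congr1 (mulmx^~ P)); rewrite /co -mulmxA PsP mulmx1 mul0mx => /rowP g0.
  by apply/rowP => j; have := g0 j; rewrite !mxE => -[].
have coZ e g : co (e *: g) = e%:C%C *: co g by rewrite /co map_mxZ -scalemxAl.
clearbody co.
have /rV0Pn[i ui] : co u != 0 by apply: contra_neq u0; apply: co0.
have couE j : co u 0 j != 0 -> r j = d.
  move=> uj; have /rowP/(_ j) := coA u.
  rewrite uA coZ mul_mx_diag [LHS]mxE [RHS]mxE.
  by rewrite [X in _ = _ * X]mxE mulrC => /(mulfI uj) [].
have ri := couE _ ui.
have hi : co h 0 i = 0.
  have /rowP/(_ 0) := parseval u h; rewrite uh !mxE (bigD1 i) //= big1 => [|j nji].
    rewrite addr0 !mxE rmorph0 => /eqP; rewrite mulf_eq0 (negPf ui) /=.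
    by rewrite conjC_eq0 => /eqP.
  case: (eqVneq (co u 0 j) 0) => [->|/couE rj]; first by rewrite mul0r.
  by move: nji; rewrite (card1 j i) ?eqxx // ?rj ?ri.
have hhE : ((h *m h^T) 0 0)%:C%C = \sum_j `|co h 0 j| ^+ 2.
  have /rowP/(_ 0) := parseval h h; rewrite !mxE => <-.
  by apply: eq_bigr => j _; rewrite !mxE normCK.
have hAhE : ((h *m A *m h^T) 0 0)%:C%C = \sum_j (r j)%:C%C * `|co h 0 j| ^+ 2.
  have /rowP/(_ 0) := parseval (h *m A) h; rewrite coA mul_mx_diag !mxE => <-.
  by apply: eq_bigr => j _; rewrite !mxE normCK mulrAC mulrC mulrA.
have : 0 < \sum_j (t - r j)%:C%C * `|co h 0 j| ^+ 2.
  rewrite lt_def sumr_ge0 => [|j _]; last first.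
    have [->|nji] := eqVneq j i; first by rewrite hi normr0 expr0n mulr0.
    rewrite mulr_ge0 ?exprn_ge0 // ler0c subr_ge0 leNgt; apply/negP => /ltW tj.
    by move: nji; rewrite (card1 j i) ?eqxx // ri.
  rewrite andbT; apply: contraTneq hh => /eqP.
  rewrite psumr_eq0 => [|j _]; last first.
    have [->|nji] := eqVneq j i; first by rewrite hi normr0 expr0n mulr0.
    rewrite mulr_ge0 ?exprn_ge0 // ler0c subr_ge0 leNgt; apply/negP => /ltW tj.
    by move: nji; rewrite (card1 j i) ?eqxx // ri.
  move=> /allP h0; suff -> : h = 0 by rewrite mul0mx mxE ltxx.
  apply: co0; apply/rowP => j; rewrite [RHS]mxE.
  have [->//|nji] := eqVneq j i.
  have := h0 j (mem_index_enum _); rewrite /= mulf_eq0 => /orP[/eqP []|].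
    move/eqP; rewrite subr_eq0 => /eqP tj.
    by move: nji; rewrite (card1 j i) ?eqxx // ?ri // tj.
  by rewrite expf_eq0 normr_eq0 => /andP[_ /eqP].
suff -> : \sum_j (t - r j)%:C%C * `|co h 0 j| ^+ 2 =
   (t * (h *m h^T) 0 0 - (h *m A *m h^T) 0 0)%:C%C.
  by rewrite ltcR subr_gt0 ltNge hAh.
rewrite rmorphB rmorphM /= hhE hAhE mulr_sumr -sumrB.
by apply: eq_bigr => j _; rewrite rmorphB mulrBl.
Qed.

(** Two eigenvalues [> t] span a plane, which contains a nonzero vector orthogonal to [u]; on it the
    quadratic form exceeds [t] times the square norm. *)
Lemma second_eigenvalue_le A u (t : R) : (1 < n)%N -> A^T = A ->
  (forall h, h *m u^T = 0 -> (h *m A *m h^T) 0 0 <= t * (h *m h^T) 0 0) ->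
  nth 0 (eigenvalues A) 1 <= t.
Proof.
move=> n1 Asym hu; rewrite leNgt; apply/negP => ltt.
have [r [P [PPs PsP AE /permP rP]]] := symmetric_spectral Asym.
have := sorted_second_gt (sorted_eigenvalues A) _ ltt.
rewrite size_eigenvalues // => /(_ n1).
rewrite rP count_map /= -size_filter.
set s := filter _ _; have : uniq s by rewrite filter_uniq ?enum_uniq.
have sP j : j \in s -> t < r j by rewrite mem_filter => /andP[].
case: s sP => [|i [|j s]] //= sP /andP[ij _] _.
have {ij} ij : i != j by move: ij; rewrite inE negb_or => /andP[].
have ti : t < r i by apply: sP; rewrite inE eqxx.
have tj : t < r j by apply: sP; rewrite !inE eqxx orbT.
(* The spectral basis is complex: the test vector is split into real and imaginary parts, both
   orthogonal to the real [u], and [hu] is applied to each. *)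
have form (v : 'rV[R[i]]_n) (B : 'M[R]_n) :
    complex.Re ((v *m cmx B *m v^t* ) 0 0) =
    (map_mx (@complex.Re R) v *m B *m (map_mx (@complex.Re R) v)^T) 0 0 +
    (map_mx (@complex.Im R) v *m B *m (map_mx (@complex.Im R) v)^T) 0 0.
  rewrite !mxE (raddf_sum (@complex.Re R : Rcomplex R -> R)) /= -big_split /=.
  apply: eq_bigr => l _; rewrite !mxE /= !big_distrl /=.
  rewrite (raddf_sum (@complex.Re R : Rcomplex R -> R)) /= -big_split /=.
  apply: eq_bigr => m _; rewrite !mxE.
  by case: (v 0 m) (v 0 l) => [? ?] [? ?] /=; ring.
pose w := P *m (cmx u)^T.
have [a [b [ab abw]]] : exists a b : R[i], (a != 0) || (b != 0)
    /\ a * w i 0 + b * w j 0 = 0.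
  have [wi|wi] := eqVneq (w i 0) 0.
    by exists 1, 0; rewrite oner_neq0 wi mulr0 mul0r addr0.
  exists (w j 0), (- w i 0); rewrite oppr_eq0 wi orbT mulNr mulrC subrr.
  by split.
pose k : 'rV[R[i]]_n := a *: delta_mx 0 i + b *: delta_mx 0 j.
pose g := k *m P.
pose x := map_mx (@complex.Re R) g; pose y := map_mx (@complex.Im R) g.
have gu : g *m (cmx u)^T = 0.
  rewrite /g -mulmxA -/w mulmxDl -!scalemxAl -!rowE; apply/rowP => z.
  have rowk l : row l w 0 0 = w l 0 by rewrite mxE.
  by rewrite ord1 [LHS]mxE [X in X + _]mxE [X in _ + X]mxE !rowk abw mxE.
have ReM (v : R[i]) (z : R) : complex.Re (v * z%:C%C) = complex.Re v * z.
  by case: v => v1 v2 /=; rewrite mulr0 subr0.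
have ImM (v : R[i]) (z : R) : complex.Im (v * z%:C%C) = complex.Im v * z.
  by case: v => v1 v2 /=; rewrite mulr0 add0r.
have xu : x *m u^T = 0.
  apply/rowP => z; have /rowP/(_ z) := gu; rewrite !mxE => /(congr1 (@complex.Re R)).
  rewrite /= (raddf_sum (@complex.Re R : Rcomplex R -> R)) /= => e; rewrite -[RHS]e.
  by apply: eq_bigr => l _; rewrite !mxE ReM.
have yu : y *m u^T = 0.
  apply/rowP => z; have /rowP/(_ z) := gu; rewrite !mxE => /(congr1 (@complex.Im R)).
  rewrite /= (raddf_sum (@complex.Im R : Rcomplex R -> R)) /= => e; rewrite -[RHS]e.
  by apply: eq_bigr => l _; rewrite !mxE ImM.
have kk : complex.Re ((g *m cmx A *m g^t* ) 0 0) =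
    r i * (complex.Re a ^+ 2 + complex.Im a ^+ 2) +
    r j * (complex.Re b ^+ 2 + complex.Im b ^+ 2).
  rewrite AE /g trmx_mul map_mxM !mulmxA -(mulmxA _ P) PPs mulmx1.
  rewrite -(mulmxA _ P) PPs mulmx1 mul_mx_diag mxE.
  rewrite (bigD1 i) //= (bigD1 j) 1?eq_sym //= big1 => [|l /andP[li lj]]; last first.
    by rewrite !mxE (negPf li) (negPf lj) !mulr0 addr0 mul0r mul0r.
  rewrite !mxE !eqxx [j == i]eq_sym (negPf ij) !mulr0 !mulr1 ?addr0 ?add0r.
  by case: a {ab abw k g x y gu xu yu} b => [? ?] [? ?] /=; ring.
have k1 : complex.Re ((g *m cmx 1%:M *m g^t* ) 0 0) =
    (complex.Re a ^+ 2 + complex.Im a ^+ 2) +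
    (complex.Re b ^+ 2 + complex.Im b ^+ 2).
  rewrite map_mx1 mulmx1 /g trmx_mul map_mxM !mulmxA -(mulmxA _ P) PPs mulmx1.
  rewrite mxE.
  rewrite (bigD1 i) //= (bigD1 j) 1?eq_sym //= big1 => [|l /andP[li lj]]; last first.
    by rewrite !mxE (negPf li) (negPf lj) !mulr0 addr0 mul0r.
  rewrite !mxE !eqxx [j == i]eq_sym (negPf ij) !mulr0 !mulr1 ?addr0 ?add0r.
  by case: a {ab abw k g x y gu xu yu kk} b => [? ?] [? ?] /=; ring.
rewrite form -/x -/y in kk; rewrite form -/x -/y !mulmx1 in k1.
have := hu _ xu; have := hu _ yu.
suff pos : 0 < (r i - t) * (complex.Re a ^+ 2 + complex.Im a ^+ 2) +
    (r j - t) * (complex.Re b ^+ 2 + complex.Im b ^+ 2).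
  by nra.
have sqpos (z : R[i]) : z != 0 -> 0 < complex.Re z ^+ 2 + complex.Im z ^+ 2.
  case: z => z1 z2; rewrite eq_complex /= => nz.
  by rewrite lt_def addr_ge0 ?sqr_ge0 // paddr_eq0 ?sqr_ge0 // !sqrf_eq0 nz.
have sqge (z : R[i]) : 0 <= complex.Re z ^+ 2 + complex.Im z ^+ 2.
  by rewrite addr_ge0 ?sqr_ge0.
case/orP: ab => [/sqpos|/sqpos] p; [apply: ltr_pwDl|apply: ltr_wpDl];
  by rewrite ?mulr_gt0 ?mulr_ge0 ?subr_gt0 ?subr_ge0 // ltW.
Qed.

End SecondEigenvalue.

(** * Laplacian bounds for the second eigenvalue *)

Section Laplacian.
Local Open Scope ring_scope.
Variables (R : realType) (G : sgraph).
Implicit Types (f h : G -> R).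

Definition lap f (x : G) : R := \sum_(y | adj x y) (f x - f y).

Definition vec f : 'rV[R]_#|G| := \row_i f (enum_val i).

Lemma adjmx_sym : (adjmx R G)^T = adjmx R G.
Proof. by apply/matrixP => i j; rewrite !mxE adj_sym. Qed.

Lemma vec_dot f h : (vec f *m (vec h)^T) 0 0 = \sum_x f x * h x.
Proof.
rewrite mxE (eq_bigl (fun x => x \in G)) // [RHS](big_enum_val (fun x => f x * h x)).
by apply: eq_bigr => i _; rewrite !mxE.
Qed.

Lemma vec_adjmx f : vec f *m adjmx R G = vec (fun x => \sum_(y | adj x y) f y).
Proof.
apply/rowP => j; rewrite !mxE.
rewrite [RHS]big_mkcond [RHS](eq_bigl (fun x => x \in G)) //.
rewrite [RHS](big_enum_val (fun y => if adj (enum_val j) y then f y else 0)).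
apply: eq_bigr => i _; rewrite !mxE adj_sym.
by case: ifP; rewrite ?mulr1 ?mulr0.
Qed.

Lemma lapE f x : lap f x = #|[set y | adj x y]|%:R * f x - \sum_(y | adj x y) f y.
Proof. by rewrite /lap sumrB sumr_const mulr_natl cardsE. Qed.

Lemma sum_mul_lap f :
  (\sum_x f x * lap f x) *+ 2 = \sum_x \sum_(y | adj x y) (f x - f y) ^+ 2.
Proof.
have swap : \sum_x f x * lap f x = \sum_x \sum_(y | adj x y) f y * (f y - f x).
  rewrite [RHS](exchange_big_dep xpredT) //=; apply: eq_bigr => x _.
  rewrite mulr_sumr; apply: eq_big => // y; first by rewrite adj_sym.
rewrite mulr2n [X in _ + X]swap -big_split /=; apply: eq_bigr => x _.
rewrite mulr_sumr -big_split /=; apply: eq_bigr => y _; ring.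
Qed.

Lemma sum_mul_lap_ge0 f : 0 <= \sum_x f x * lap f x.
Proof.
rewrite -(@pmulrn_lge0 _ _ 2) // sum_mul_lap.
by apply: sumr_ge0 => x _; apply: sumr_ge0 => y _; apply: sqr_ge0.
Qed.

(** Apply [second_eigenvalue_ge] with the constant vector, of eigenvalue [d], for [u] and the
    Rayleigh quotient of [h] for [t]; [t <= d] holds because the Laplacian form is nonnegative. *)
Lemma lambda2_poincare d h : regular d G -> (1 < #|G|)%N ->
  \sum_x h x = 0 -> 0 < \sum_x h x ^+ 2 ->
  (d%:R - lambda2 R G) * \sum_x h x ^+ 2 <= \sum_x h x * lap h x.
Proof.
move=> dreg G1 h0 hh; set N := \sum_x h x ^+ 2 in hh *.
set E := \sum_x h x * lap h x.
suff : d%:R - E / N <= lambda2 R G.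
  by move=> le; rewrite -ler_pdivlMr // lerBlDr addrC -lerBlDr.
have hhE : (vec h *m (vec h)^T) 0 0 = N.
  by rewrite vec_dot; apply: eq_bigr => x _; rewrite expr2.
apply: (@second_eigenvalue_ge _ _ _ (vec (fun=> 1)) (vec h) _ d%:R) => //.
- exact: adjmx_sym.
- have [i _] : exists i : 'I_#|G|, true by exists (Ordinal (ltnW G1)).
  by apply/eqP => /rowP/(_ i); rewrite !mxE => /eqP; rewrite oner_eq0.
- rewrite vec_adjmx; apply/rowP => i; rewrite !mxE sumr_const -cardsE dreg.
  by rewrite mulr1.
- apply/rowP => i; rewrite ord1 vec_dot mxE -[RHS]h0.
  by apply: eq_bigr => x _; rewrite mul1r.
- by rewrite gerBl divr_ge0 ?sum_mul_lap_ge0 // ltW.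
- by rewrite hhE.
rewrite hhE vec_adjmx vec_dot mulrBl divfK ?gt_eqF // /N mulr_sumr /E -sumrB.
apply: ler_sum => x _; by rewrite lapE dreg le_eqVlt; apply/orP; left; apply/eqP; ring.
Qed.

(** The adjacency form is the degree form minus the Laplacian form, so upper bounds on the degrees
    are what bounds it. *)
Lemma lambda2_le d (mu : R) : (forall x : G, #|[set y | adj x y]| <= d)%N ->
  (1 < #|G|)%N ->
  (forall h, \sum_x h x = 0 -> mu * \sum_x h x ^+ 2 <= \sum_x h x * lap h x) ->
  lambda2 R G <= d%:R - mu.
Proof.
move=> dle G1 hmu; apply: (@second_eigenvalue_le _ _ _ (vec (fun=> 1))) => //.
  exact: adjmx_sym.
move=> v; pose h x := v 0 (enum_rank x).
have -> : v = vec h by apply/rowP => i; rewrite mxE /h enum_valK.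
move=> /rowP/(_ 0); rewrite vec_dot mxE => h0.
rewrite vec_adjmx !vec_dot mulrBl lerBrDr -lerBrDl.
under [X in mu * X]eq_bigr do rewrite -expr2.
have /hmu le : \sum_x h x = 0 by rewrite -[RHS]h0; apply: eq_bigr => x _; rewrite mulr1.
apply: le_trans le _; rewrite mulr_sumr -sumrB; apply: ler_sum => x _.
rewrite lapE mulrBr [X in _ <= _ - X]mulrC lerB // mulrCA ler_wpM2r // ?ler_nat //.
by rewrite -expr2 sqr_ge0.
Qed.

(** Scaling [f] by [s] on [X] and by [t] off [X] makes it orthogonal to the constants. The form of
    [lap - mu] becomes [s^2] and [t^2] times the two given sums plus [(s - t)^2] times a sum of
    products [f x * f y] over the edges leaving [X], which is [<= 0] since the signs are
    opposite. *)
Lemma two_part_lambda2 d f (X : {set G}) (mu : R) :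
  regular d G -> (1 < #|G|)%N ->
  {in X, forall x, 0 <= f x} -> {in ~: X, forall x, f x <= 0} ->
  0 < \sum_(x in X) f x -> \sum_(x in ~: X) f x < 0 ->
  \sum_(x in X) f x * (lap f x - mu * f x) <= 0 ->
  \sum_(x in ~: X) f x * (lap f x - mu * f x) <= 0 ->
  d%:R - mu <= lambda2 R G /\
  (lambda2 R G <= d%:R - mu ->
     \sum_(x in X) f x * (lap f x - mu * f x) = 0 /\
     \sum_(x in ~: X) f x * (lap f x - mu * f x) = 0).
Proof.
move=> dreg G1 fX fY; set a := \sum_(x in X) f x; set b := \sum_(x in ~: X) f x.
move=> a0 b0; set SX := \sum_(x in X) _; set SY := \sum_(x in ~: X) _ => SX0 SY0.
pose s := - b; pose t := a.
have s0 : 0 < s by rewrite oppr_gt0.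
pose h x := (if x \in X then s else t) * f x.
have bigX (F : G -> R) : \sum_x F x = \sum_(x in X) F x + \sum_(x in ~: X) F x.
  by rewrite (bigID (mem X)) /=; congr (_ + _); apply: eq_bigl => x; rewrite inE.
have h0 : \sum_x h x = 0.
  rewrite bigX (eq_bigr (fun x => s * f x)) => [|x xX]; last by rewrite /h xX.
  rewrite [X in _ + X](eq_bigr (fun x => t * f x)) => [|x]; last first.
    by rewrite inE /h => /negPf ->.
  by rewrite -!mulr_sumr -/a -/b /s /t mulNr mulrC addNr.
pose M := \sum_(x in X) \sum_(y in ~: X | adj x y) f x * f y.
have M0 : M <= 0.
  apply: sumr_le0 => x xX; apply: sumr_le0 => y /andP[yX _].
  by rewrite mulr_ge0_le0 ?fX ?fY.
have EX : \sum_(x in X) h x * lap h x =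
    s ^+ 2 * (\sum_(x in X) f x * lap f x) + s * (s - t) * M.
  rewrite !mulr_sumr -big_split /=; apply: eq_bigr => x xX.
  rewrite /lap !mulr_sumr [X in _ + X]big_mkcondl /= -big_split /=.
  by apply: eq_bigr => y _; rewrite /h inE xX; case: (y \in X) => /=; ring.
have EY : \sum_(x in ~: X) h x * lap h x =
    t ^+ 2 * (\sum_(x in ~: X) f x * lap f x) + t * (t - s) * M.
  rewrite /M (exchange_big_dep (mem (~: X))) /=; last by move=> x y _ /andP[].
  rewrite !mulr_sumr -big_split /=; apply: eq_bigr => x xX.
  rewrite (eq_bigl (fun y => (y \in X) && adj x y)); last first.
    by move=> y; rewrite xX adj_sym.
  rewrite /lap !mulr_sumr [X in _ + X]big_mkcondl /= -big_split /=.
  rewrite inE in xX.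
  by apply: eq_bigr => y _; rewrite /h (negPf xX); case: (y \in X) => /=; ring.
have NX : \sum_(x in X) h x ^+ 2 = s ^+ 2 * \sum_(x in X) f x ^+ 2.
  by rewrite mulr_sumr; apply: eq_bigr => x xX; rewrite /h xX exprMn.
have NY : \sum_(x in ~: X) h x ^+ 2 = t ^+ 2 * \sum_(x in ~: X) f x ^+ 2.
  rewrite mulr_sumr; apply: eq_bigr => x; rewrite inE => /negPf xX.
  by rewrite /h xX exprMn.
have SXE : SX = \sum_(x in X) f x * lap f x - mu * \sum_(x in X) f x ^+ 2.
  by rewrite mulr_sumr -sumrB; apply: eq_bigr => x _; ring.
have SYE : SY = \sum_(x in ~: X) f x * lap f x - mu * \sum_(x in ~: X) f x ^+ 2.
  by rewrite mulr_sumr -sumrB; apply: eq_bigr => x _; ring.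
have total : \sum_x h x * lap h x - mu * \sum_x h x ^+ 2 =
    s ^+ 2 * SX + t ^+ 2 * SY + (s - t) ^+ 2 * M.
  by rewrite !bigX EX EY NX NY SXE SYE; ring.
have hh : 0 < \sum_x h x ^+ 2.
  rewrite lt_def sumr_ge0 ?andbT => [|x _]; last exact: sqr_ge0.
  apply: contraTneq a0 => /eqP; rewrite psumr_eq0 => [/allP H|x _]; last exact: sqr_ge0.
  rewrite /a big1 ?ltxx // => x xX; have := H x (mem_index_enum _).
  by rewrite /= sqrf_eq0 /h xX mulf_eq0 gt_eqF //= => /eqP.
have P := lambda2_poincare dreg G1 h0 hh.
have cross0 : (s - t) ^+ 2 * M <= 0 by rewrite mulr_ge0_le0 ?sqr_ge0.
have s20 : 0 < s ^+ 2 by rewrite exprn_gt0.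
have t20 : 0 < t ^+ 2 by rewrite exprn_gt0.
have sSX : s ^+ 2 * SX <= 0 by rewrite mulr_ge0_le0 // ltW.
have tSY : t ^+ 2 * SY <= 0 by rewrite mulr_ge0_le0 // ltW.
have le1 : (d%:R - lambda2 R G - mu) * \sum_x h x ^+ 2 <=
   s ^+ 2 * SX + t ^+ 2 * SY by rewrite mulrBl; lra.
split.
  suff : d%:R - lambda2 R G - mu <= 0 by lra.
  by rewrite -(pmulr_lle0 _ hh); lra.
move=> le2; have : 0 <= (d%:R - lambda2 R G - mu) * \sum_x h x ^+ 2.
  by rewrite mulr_ge0 ?(ltW hh) //; lra.
move=> ge; have e1 : s ^+ 2 * SX = 0 by apply/eqP; rewrite eq_le; apply/andP; split; lra.
have e2 : t ^+ 2 * SY = 0 by apply/eqP; rewrite eq_le; apply/andP; split; lra.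
by split; apply/eqP; [move/eqP: e1|move/eqP: e2]; rewrite mulf_eq0 gt_eqF.
Qed.

End Laplacian.

(** * Sequential joins *)

Section PathPoincare.
Local Open Scope ring_scope.

(* With [T], [S] the partial sums of [m y], [m x], Abel summation gives
   [Q = sum m y^2 = sum T (y_i - y_(i+1))]; Picone's inequality for the positive
   sequence [S] gives [mu sum T^2 / w <= Q], and completing the square in
   [sum w (y_i - y_(i+1))^2] concludes. *)
Lemma path_poincare (R : realFieldType) (K : nat) (m x y : nat -> R) (mu : R) :
  0 < mu -> (forall i, (i <= K.+1)%N -> 0 < m i) ->
  (forall i, (i <= K)%N -> x i.+1 < x i) ->
  (forall i, (i <= K)%N ->
     m i * m i.+1 * (x i - x i.+1) = mu * \sum_(j < i.+1) m j * x j) ->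
  \sum_(j < K.+2) m j * x j = 0 -> \sum_(j < K.+2) m j * y j = 0 ->
  mu * \sum_(j < K.+2) m j * y j ^+ 2 <=
  \sum_(i < K.+1) m i * m i.+1 * (y i - y i.+1) ^+ 2.
Proof.
move=> mu0 m0 xdec flux xsum ysum.
pose T i := \sum_(j < i.+1) m j * y j; pose S i := \sum_(j < i.+1) m j * x j.
pose w i := m i * m i.+1.
have w0 i : (i <= K)%N -> 0 < w i by move=> iK; rewrite mulr_gt0 ?m0 // ltnW.
have S0 i : (i <= K)%N -> 0 < S i.
  move=> iK; rewrite -(pmulr_rgt0 _ mu0) -flux // mulr_gt0 ?w0 //.
  by rewrite subr_gt0 xdec.
have TS i : T i.+1 = T i + m i.+1 * y i.+1 by rewrite /T big_ord_recr.
have SS i : S i.+1 = S i + m i.+1 * x i.+1 by rewrite /S big_ord_recr.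
pose Q i := \sum_(j < i.+1) m j * y j ^+ 2.
have QS i : Q i.+1 = Q i + m i.+1 * y i.+1 ^+ 2 by rewrite /Q big_ord_recr.
have abel i : Q i = \sum_(j < i) T j * (y j - y j.+1) + T i * y i.
  elim: i => [|i IH]; first by rewrite /Q /T big_ord0 !big_ord1; ring.
  by rewrite QS IH big_ord_recr /= TS; ring.
(* Picone's inequality, with the boundary term kept. Only indices up to [K] are reached, because
   [S K.+1 = 0]. *)
have picone i : (i <= K)%N ->
    \sum_(j < i) T j ^+ 2 / S j * (x j - x j.+1) + T i ^+ 2 / S i * x i <= Q i.
  elim: i => [|i IH] iK.
    have := S0 0%N iK; rewrite /Q /T /S big_ord0 !big_ord1 => s0.
    have x0 : x 0%N != 0 by apply: contraTneq s0 => ->; rewrite mulr0 ltxx.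
    have m00 : m 0%N != 0 by rewrite gt_eqF ?m0.
    by rewrite le_eqVlt; apply/orP; left; apply/eqP; field; rewrite m00 x0.
  have {}IH := IH (ltnW iK); have Si := S0 _ (ltnW iK); have Si1 := S0 _ iK.
  have mi := m0 i.+1 (ltnW iK).
  rewrite QS big_ord_recr /=.
  suff : T i.+1 ^+ 2 / S i.+1 * x i.+1 <=
         m i.+1 * y i.+1 ^+ 2 + T i ^+ 2 / S i * x i.+1.
    by move: IH; lra.
  have yE : y i.+1 = (T i.+1 - T i) / m i.+1 by rewrite TS; field; rewrite gt_eqF.
  have xE : x i.+1 = (S i.+1 - S i) / m i.+1 by rewrite SS; field; rewrite gt_eqF.
  (* The excess at one step is a square over a positive denominator. *)
  rewrite yE xE -subr_ge0.
  have -> : m i.+1 * ((T i.+1 - T i) / m i.+1) ^+ 2 +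
      T i ^+ 2 / S i * ((S i.+1 - S i) / m i.+1) -
      T i.+1 ^+ 2 / S i.+1 * ((S i.+1 - S i) / m i.+1) =
      (S i * T i.+1 - S i.+1 * T i) ^+ 2 / (m i.+1 * S i * S i.+1).
    by field; rewrite !gt_eqF.
  by rewrite divr_ge0 ?sqr_ge0 // !mulr_ge0 // ltW.
have TK : T K.+1 = 0 by [].
have SK : S K.+1 = 0 by [].
(* At [K.+1] both partial sums vanish, so the last term of [Q] is [- (T K ^+ 2 / S K * x K.+1)];
   with the boundary term of [picone] it gives the summand of index [K]. *)
have Qge : \sum_(j < K.+1) T j ^+ 2 / S j * (x j - x j.+1) <= Q K.+1.
  have := picone K (leqnn K); rewrite QS big_ord_recr /=.
  have SK0 := S0 K (leqnn K); have mK := m0 K.+1 (leqnn _).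
  have := SS K; rewrite SK => /esym/eqP; rewrite addr_eq0 => /eqP SKE.
  have := TS K; rewrite TK => /esym/eqP; rewrite addr_eq0 => /eqP TKE.
  have xn0 : x K.+1 != 0.
    by apply: contraTneq SK0 => z; rewrite SKE z mulr0 oppr0 ltxx.
  have -> : m K.+1 * y K.+1 ^+ 2 = - (T K ^+ 2 / S K * x K.+1).
    by rewrite TKE SKE; field; rewrite xn0 gt_eqF.
  lra.
have QE : Q K.+1 = \sum_(j < K.+1) T j * (y j - y j.+1).
  by rewrite abel TK mul0r addr0.
have Qge' : mu * (mu * \sum_(j < K.+1) T j ^+ 2 / w j) <= mu * Q K.+1.
  apply: ler_wpM2l; first exact: ltW.
  apply: le_trans Qge; rewrite mulr_sumr.
  apply: ler_sum => j _; have jK : (j <= K)%N by rewrite -ltnS.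
  have Sj := S0 _ jK; have wj := w0 _ jK.
  have -> : x j - x j.+1 = mu * S j / w j.
    by rewrite -flux // mulrC mulKf // gt_eqF.
  by rewrite le_eqVlt; apply/orP; left; apply/eqP; field; rewrite !gt_eqF.
have sq : 0 <= \sum_(j < K.+1) (w j * (y j - y j.+1) - mu * T j) ^+ 2 / w j.
  by apply: sumr_ge0 => j _; rewrite divr_ge0 ?sqr_ge0 // ltW // w0 // -ltnS.
have sqE : \sum_(j < K.+1) (w j * (y j - y j.+1) - mu * T j) ^+ 2 / w j =
    \sum_(j < K.+1) w j * (y j - y j.+1) ^+ 2
    - 2 * mu * (\sum_(j < K.+1) T j * (y j - y j.+1))
    + mu * (mu * \sum_(j < K.+1) T j ^+ 2 / w j).
  rewrite !mulr_sumr -sumrB -big_split /=; apply: eq_bigr => j _.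
  have wj : w j != 0 by rewrite gt_eqF // w0 // -ltnS.
  by field; rewrite wj.
rewrite sqE -QE in sq.
by rewrite -/(Q K.+1) -/(w _); move: sq Qge'; lra.
Qed.

End PathPoincare.

Section CompleteJoin.
Local Open Scope ring_scope.
Variables (R : realFieldType) (I J : finType) (f : I -> R) (g : J -> R).

Lemma sum_sqr_mean (a : R) : (0 < #|I|)%N -> a = (\sum_i f i) / #|I|%:R ->
  \sum_i f i ^+ 2 = #|I|%:R * a ^+ 2 + \sum_i (f i - a) ^+ 2.
Proof.
move=> I0 aE; have nz : #|I|%:R != 0 :> R by rewrite pnatr_eq0 -lt0n.
have sE : \sum_i f i = #|I|%:R * a by rewrite aE mulrC divfK.
have -> : \sum_i (f i - a) ^+ 2 = \sum_i f i ^+ 2 - 2 * a * (\sum_i f i) + \sum_(i : I) a ^+ 2.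
  by rewrite mulr_sumr -sumrB -big_split /=; apply: eq_bigr => i _; ring.
by rewrite sE sumr_const mulr_natl; ring.
Qed.

(** Expanding around the two means, the cross terms vanish: the energy of a complete join separates
    into the difference of the means and the deviations inside each cell. *)
Lemma sum_sqr_sub (a b : R) : (0 < #|I|)%N -> (0 < #|J|)%N ->
  a = (\sum_i f i) / #|I|%:R -> b = (\sum_j g j) / #|J|%:R ->
  \sum_i \sum_j (f i - g j) ^+ 2 = #|I|%:R * #|J|%:R * (a - b) ^+ 2 +
    #|J|%:R * (\sum_i (f i - a) ^+ 2) + #|I|%:R * (\sum_j (g j - b) ^+ 2).
Proof.
move=> I0 J0 aE bE.
have nzI : #|I|%:R != 0 :> R by rewrite pnatr_eq0 -lt0n.
have nzJ : #|J|%:R != 0 :> R by rewrite pnatr_eq0 -lt0n.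
have fI : \sum_i (f i - a) = 0.
  by rewrite sumrB sumr_const -[a *+ _]mulr_natl aE mulrC divfK ?subrr.
have gJ : \sum_j (g j - b) = 0.
  by rewrite sumrB sumr_const -[b *+ _]mulr_natl bE mulrC divfK ?subrr.
have inner i : \sum_j (f i - g j) ^+ 2 = #|J|%:R * (f i - a) ^+ 2 +
   2 * #|J|%:R * (a - b) * (f i - a) + (#|J|%:R * (a - b) ^+ 2 + \sum_j (g j - b) ^+ 2).
  have -> : \sum_j (f i - g j) ^+ 2 =
     \sum_(j : J) (f i - b) ^+ 2 - 2 * (f i - b) * (\sum_j (g j - b)) + \sum_j (g j - b) ^+ 2.
    by rewrite mulr_sumr -sumrB -big_split /=; apply: eq_bigr => j _; ring.
  by rewrite gJ sumr_const mulr_natl; ring.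
rewrite (eq_bigr _ (fun i _ => inner i)) big_split sumr_const big_split /=.
rewrite -!mulr_sumr fI.
by rewrite -[X in _ + X = _]mulr_natl; ring.
Qed.

End CompleteJoin.

Section SeqJoinBound.
Local Open Scope ring_scope.
Variable R : realType.

Lemma sum_tagged (I : finType) (J : I -> finType) (F : {i : I & J i} -> R) P :
  \sum_(u | P (tag u)) F u = \sum_(i | P i) \sum_(x : J i) F (Tagged J x).
Proof.
rewrite (@sig_big_dep _ _ _ _ _ _ (fun=> xpredT) (fun i x => F (Tagged J x))).
by apply: eq_big => [u|[i x] _] //; rewrite andbT.
Qed.

Lemma sum_ord_next (n : nat) (F : 'I_n.+2 -> 'I_n.+2 -> R) :
  \sum_(i < n.+2) \sum_(j : 'I_n.+2 | i.+1 == j :> nat) F i j =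
  \sum_(i < n.+1) F (inord i) (inord i.+1).
Proof.
rewrite big_ord_recr /= [X in _ + X]big_pred0 ?addr0 => [|j]; last first.
  by apply: gtn_eqF; apply: ltn_ord.
apply: eq_bigr => i _; rewrite (big_pred1 (inord i.+1)) => [|j].
  congr (F _ _); apply: val_inj; rewrite /= inordK //.
  by have := ltn_ord i; lia.
rewrite /= -val_eqE /= inordK ?ltnS // 1?eq_sym //.
by rewrite -ltnS ltn_ord.
Qed.

(** Split [h] into cell means and deviations. The means are treated by [path_poincare], the flux
    condition being the summed eigenvector equation of the path. Every deviation meets a nonempty
    neighbouring cell, so its energy is at least its square norm, and [mu <= 1]. Edges inside cells
    only add energy. *)
Lemma lambda2_seqjoin_le (s : seq sgraph) (d : nat) (x : nat -> R) (mu : R) :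
  let m i : R := #|nth (complete 0) s i|%:R in
  (2 <= size s)%N ->
  (forall i, (i < size s)%N -> (0 < #|nth (complete 0) s i|)%N) ->
  (forall u : seqjoin s, #|[set v | adj u v]| <= d)%N ->
  0 < mu <= 1 ->
  (forall i, (i.+1 < size s)%N -> x i.+1 < x i) ->
  (forall i, (i.+1 < size s)%N ->
     m i * m i.+1 * (x i - x i.+1) = mu * \sum_(j < i.+1) m j * x j) ->
  \sum_(j < size s) m j * x j = 0 ->
  lambda2 R (seqjoin s) <= d%:R - mu.
Proof.
case: s => [|C0 [|C1 s]] //; set S := C0 :: C1 :: s; set L := size s.
move=> m _ C_gt0 degle /andP[mu0 mu1] xdec flux xsum.
have m0 i : (i <= L.+1)%N -> 0 < m i by move=> iL; rewrite ltr0n C_gt0.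
pose J (i : 'I_L.+2) : finType := nth (complete 0) S i.
have card2 : (1 < #|seqjoin S|)%N.
  have [x0 _] : exists y : J ord0, true.
    by case/card_gt0P: (C_gt0 0%N isT) => y _; exists y.
  have [x1 _] : exists y : J (lift ord0 ord0), true.
    by case/card_gt0P: (C_gt0 1%N isT) => y _; exists y.
  pose u0 : seqjoin S := Tagged J x0; pose u1 : seqjoin S := Tagged J x1.
  rewrite (cardD1 u0) (cardD1 u1) !inE.
  suff -> : u1 != u0 by [].
  by apply/eqP => /(congr1 tag).
apply: lambda2_le => // h hsum.
pose hi (i : 'I_L.+2) (y : J i) := h (Tagged J y).
pose M i := (\sum_y hi i y) / #|J i|%:R.
pose V i := \sum_y (hi i y - M i) ^+ 2.
have V0 i : 0 <= V i by apply: sumr_ge0 => y _; apply: sqr_ge0.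
have J0 (i : 'I_L.+2) : (0 < #|J i|)%N by rewrite C_gt0.
have sumh2 : \sum_u h u ^+ 2 = \sum_(i < L.+2) m i * M i ^+ 2 + \sum_i V i.
  rewrite (sum_tagged (J := J) (fun u => h u ^+ 2) xpredT) -big_split /=.
  by apply: eq_bigr => i _; apply: (sum_sqr_mean (f := hi i) (a := M i)).
pose y i := M (inord i).
have ysum : \sum_(j < L.+2) m j * y j = 0.
  rewrite -[RHS]hsum (sum_tagged (J := J) h xpredT); apply: eq_bigr => i _.
  by rewrite /y inord_val /M mulrC divfK // gt_eqF // m0 // -ltnS.
(* Read from left to right, each edge between cells is counted once, which accounts for the factor 2
   in [sum_mul_lap]. *)
pose E := \sum_(u : seqjoin S) \sum_(v : seqjoin S | (tag u).+1 == tag v) (h u - h v) ^+ 2.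
have energy : E <= \sum_u h u * lap h u.
  rewrite -(ler_pMn2r (n := 2)) // sum_mul_lap mulr2n.
  rewrite [X in X + _](_ : _ = \sum_(u : seqjoin S) \sum_(v : seqjoin S | (tag v).+1 == tag u) (h u - h v) ^+ 2); last first.
    rewrite /E (exchange_big_dep xpredT) //=; apply: eq_bigr => u _.
    by apply: eq_bigr => v _; rewrite -sqrrN opprB.
  rewrite -big_split /=; apply: ler_sum => u _.
  rewrite [X in X + _]big_mkcond [X in _ + X]big_mkcond -big_split /=.
  rewrite [X in _ <= X]big_mkcond; apply: ler_sum => v _.
  rewrite /adj /= /seqjoin_adj; case: (tag u =P tag v) => [<-|nuv].
    by rewrite [_.+1 == _]gtn_eqF // addr0; case: ifP; rewrite ?sqr_ge0.
  case: eqP => [e1|]; case: eqP => [e2|]; rewrite ?addr0 ?add0r //=.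
  by move: e1 e2; lia.
apply: le_trans energy.
have EE : E = \sum_(i < L.+2) \sum_(j : 'I_L.+2 | i.+1 == j :> nat)
   \sum_a \sum_b (hi i a - hi j b) ^+ 2.
  rewrite /E (sum_tagged (J := J) _ xpredT); apply: eq_bigr => i _ /=.
  rewrite [RHS]exchange_big /=; apply: eq_bigr => a _ /=.
  by rewrite (sum_tagged (J := J) (fun v => (hi i a - h v) ^+ 2) (fun j => i.+1 == j)).
have Ege : \sum_(i < L.+1) m i * m i.+1 * (y i - y i.+1) ^+ 2 + \sum_i V i <= E.
  rewrite EE (@sum_ord_next L (fun i j => \sum_a \sum_b (hi i a - hi j b) ^+ 2)).
  (* One copy of each deviation suffices: cell 0 is charged to the first pair, cell [i.+1] to the
     pair [(i, i.+1)]. *)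
  have : \sum_i V i <= \sum_(i < L.+1) (V (inord i) + V (inord i.+1)).
    rewrite big_ord_recl big_split /= lerD //.
      rewrite (bigD1 ord0) //= (_ : inord _ = ord0); last by apply: val_inj; rewrite /= inordK.
      by rewrite lerDl sumr_ge0.
    apply: ler_sum => i _; rewrite le_eqVlt; apply/orP; left; apply/eqP.
    by congr V; apply: val_inj; rewrite /= inordK // ltnS.
  rewrite -(lerD2l (\sum_(i < L.+1) m i * m i.+1 * (y i - y i.+1) ^+ 2)).
  move=> le; apply: le_trans le _; rewrite -big_split /=; apply: ler_sum => i _.
  rewrite (sum_sqr_sub (f := hi (inord i)) (g := hi (inord i.+1)) (J0 _) (J0 _) (erefl (M _)) (erefl (M _))).
  have iL : (i <= L)%N by rewrite -ltnS.
  have mi : #|J (inord i)|%:R = m i by rewrite /J /m inordK // ltnW.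
  have mi1 : #|J (inord i.+1)|%:R = m i.+1 by rewrite /J /m inordK.
  rewrite mi mi1.
  rewrite -addrA lerD2l lerD // ler_peMl ?V0 //.
    by rewrite /m ler1n C_gt0.
  by rewrite /m ler1n C_gt0 // ltnW.
apply: le_trans Ege; rewrite sumh2 mulrDr lerD //.
  rewrite (eq_bigr (fun i : 'I_L.+2 => m i * y i ^+ 2)) => [|i _]; last by rewrite /y inord_val.
  exact: (path_poincare (x := x)).
by rewrite ler_piMl // sumr_ge0.
Qed.

End SeqJoinBound.

(** * The five-cell model *)

Section Model.
Local Open Scope ring_scope.
Variable R : realType.
Implicit Types a b c e mu : R.

(* [gap_poly a b (c + e) (c * e)] vanishes at the spectral gap of the weighted path
   with masses [a - c, c, 1, e, b - e] and conductances [c (a - c), c, e, e (b - e)].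
   It depends on [c] and [e] only through [c + e] and [c * e]. *)
Definition gap_poly a b d p mu : R :=
  mu * (a + 1 - mu) * (b + 1 - mu) * (d - mu) - p * (a + b + 1 - 2 * mu).

(** At 0 the polynomial is [- p * (a + b + 1) < 0], so the intermediate value theorem applies. This
    serves both for the existence of a gap and for comparing the gaps of two products [p]. *)
Lemma gap_poly_root a b d p M : 0 < a -> 0 < b -> 0 < p -> 0 < M ->
  0 < gap_poly a b d p M ->
  exists mu, [/\ 0 < mu, mu < M & gap_poly a b d p mu = 0].
Proof.
move=> a0 b0 p0 M0 PM.
pose P : {poly R} := 'X * ((a + 1)%:P - 'X) * ((b + 1)%:P - 'X) * (d%:P - 'X)
   - p%:P * ((a + b + 1)%:P - 2%:P * 'X).
have PE x : P.[x] = gap_poly a b d p x by rewrite /P /gap_poly !hornerE.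
have [|mu mu01 /eqP] := @poly_ivtoo _ P 0 M (ltW M0).
  rewrite pmulr_llt0 PE // /gap_poly; nra.
by rewrite PE => mu0; exists mu; move: mu01; rewrite in_itv => /andP[].
Qed.

(** The claim is [p * (a + b - 1) < a * b * (d - 1)]. It follows from [p <= d^2 / 4] and from
    [(d + 1) * (a + b) <= 2 * a * b], a consequence of the bounds on [a] and [b]. *)
Lemma gap_poly1_gt0 a b d p : 3 <= d -> d + 1 <= a -> d + 1 <= b -> 4 * p <= d ^+ 2 ->
  0 < gap_poly a b d p 1.
Proof.
move=> d3 da db pd; rewrite /gap_poly.
have h1 : (d + 1) * (a + b) <= 2 * (a * b) by nra.
have h2 : d ^+ 2 <= 2 * (d - 1) * (d + 1) by nra.
have h3 : 4 * p * (a + b - 1) <= d ^+ 2 * (a + b - 1) by rewrite ler_wpM2r //; lra.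
have h4 : d ^+ 2 * (a + b) <= 2 * (d - 1) * (d + 1) * (a + b) by rewrite ler_wpM2r //; lra.
have h5 : (d - 1) * ((d + 1) * (a + b)) <= (d - 1) * (2 * (a * b)) by rewrite ler_wpM2l //; lra.
have h6 : 0 < d ^+ 2 by rewrite exprn_gt0 //; lra.
by move: h3 h4 h5 h6; rewrite !mulrBr !mulrDr; nra.
Qed.

Lemma gap_polyB a b d p q mu :
  gap_poly a b d q mu = gap_poly a b d p mu + (p - q) * (a + b + 1 - 2 * mu).
Proof. by rewrite /gap_poly; ring. Qed.

(** The vector meant is [c * s, (c - mu) * s, g, - (e - mu) * t, - e * t]. It satisfies the
    equations of the end cells by its form; those of the cells next to the centre are the two
    formulas for [g], and the last condition says that the weighted sum is zero. *)
Lemma gap_vector a b c e mu : 1 <= c -> 1 <= e -> 1 <= a -> 1 <= b ->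
  0 < mu -> mu < 1 -> gap_poly a b (c + e) (c * e) mu = 0 ->
  exists s t g, [/\ 0 < s, 0 < t, g = s * (c - mu * (a + 1 - mu)),
    g = - t * (e - mu * (b + 1 - mu)) & s * c * (a - mu) + g = t * e * (b - mu)].
Proof.
move=> c1 e1 a1 b1 mu0 mu1 gap.
set X := c - _; set Y := e - _.
(* The gap equation is what remains of these conditions when [s], [t] and [g] are eliminated. *)
have key : c * (a - mu) * Y + e * (b - mu) * X + X * Y = 0.
  by rewrite -[RHS]oppr0 -gap /X /Y /gap_poly; ring.
have cD : 0 < c * (a - mu) by apply: mulr_gt0; lra.
have eD : 0 < e * (b - mu) by apply: mulr_gt0; lra.
have XcD : 0 < X + c * (a - mu).
  have -> : X + c * (a - mu) = (c - mu) * (a + 1 - mu) by rewrite /X; ring.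
  by apply: mulr_gt0; lra.
clearbody X Y.
(* The ratio [s : t] is [Y : - X], so positivity needs opposite signs for [X] and [Y]; if both
   vanish, the zero-sum condition alone fixes the ratio. *)
case: (ltgtP X 0) => X0.
- have Y0 : 0 < Y.
    rewrite ltNge; apply/negP => Y0.
    have : (X + c * (a - mu)) * Y <= 0 by rewrite pmulr_rle0.
    have : e * (b - mu) * X < 0 by rewrite pmulr_rlt0.
    by lra.
  exists Y, (- X), (X * Y); split => //; rewrite ?oppr_gt0 ?opprK //; first by ring.
  by move: key; lra.
- have Y0 : Y < 0.
    rewrite ltNge; apply/negP => Y0.
    have : 0 <= c * (a - mu) * Y by rewrite pmulr_rge0.
    have : 0 < e * (b - mu) * X by rewrite pmulr_rgt0.
    have : 0 <= X * Y by rewrite pmulr_rge0.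
    by lra.
  exists (- Y), X, (- (X * Y)); split; rewrite ?oppr_gt0 //; try ring.
  by move: key; lra.
- exists (e * (b - mu)), (c * (a - mu)), 0.
  have Y0 : Y = 0.
    move/eqP: key; rewrite X0 mulr0 mul0r !addr0 mulf_eq0 (gt_eqF cD) /= => /eqP //.
  by rewrite X0 Y0 !mulr0; split => //; ring.
Qed.

(** The vector of [gap_vector] decreases along the path, its successive differences being [mu] times
    positive quantities ([dec1] to [dec4]), and so is admissible in [lambda2_seqjoin_le]. *)
Lemma lambda2_five_cells (C0 C1 C2 C3 C4 : sgraph) (n0 c e n4 : nat) mu :
  let s := [:: C0; C1; C2; C3; C4] in
  #|C0| = n0 -> #|C1| = c -> #|C2| = 1%N -> #|C3| = e -> #|C4| = n4 ->
  (0 < n0)%N -> (0 < c)%N -> (0 < e)%N -> (0 < n4)%N ->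
  (forall u : seqjoin s, #|[set v | adj u v]| <= c + e)%N ->
  0 < mu -> mu < 1 ->
  gap_poly (n0 + c)%:R (n4 + e)%:R (c%:R + e%:R) (c%:R * e%:R) mu = 0 ->
  lambda2 R (seqjoin s) <= (c + e)%:R - mu.
Proof.
move=> s card0 card1 card2 card3 card4 n00 c0 e0 n40 deg mu0 mu1 gap.
have n0r : 1 <= n0%:R :> R by rewrite ler1n.
have n4r : 1 <= n4%:R :> R by rewrite ler1n.
have cr : 1 <= c%:R :> R by rewrite ler1n.
have er : 1 <= e%:R :> R by rewrite ler1n.
have [|||| s0 [t [g [sp tp gA gB bal]]]] := gap_vector _ _ _ _ mu0 mu1 gap; try by rewrite ?natrD; lra.
rewrite !natrD in gA gB bal.
set cc : R := c%:R in cr gA gB bal *; set ee : R := e%:R in er gA gB bal *.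
set nn0 : R := n0%:R in n0r gA gB bal *; set nn4 : R := n4%:R in n4r gA gB bal *.
pose x := nth 0 [:: cc * s0; (cc - mu) * s0; g; - (ee - mu) * t; - ee * t].
have dec1 : 0 < mu * s0 by rewrite mulr_gt0.
have dec4 : 0 < mu * t by rewrite mulr_gt0.
have sD : 0 < s0 * (nn0 + cc - mu) by apply: mulr_gt0 => //; lra.
have tD : 0 < t * (nn4 + ee - mu) by apply: mulr_gt0 => //; lra.
have dec2 : 0 < mu * (s0 * (nn0 + cc - mu)) by rewrite mulr_gt0.
have dec3 : 0 < mu * (t * (nn4 + ee - mu)) by rewrite mulr_gt0.
have e2 : (cc - mu) * s0 - g = mu * (s0 * (nn0 + cc - mu)) by rewrite gA; ring.
have e3 : g - - (ee - mu) * t = mu * (t * (nn4 + ee - mu)) by rewrite gB; ring.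
apply: (@lambda2_seqjoin_le _ s (c + e) x) => //.
- case=> [|[|[|[|[|i]]]]] //= _; rewrite ?card0 ?card1 ?card2 ?card3 ?card4 //.
- by rewrite mu0 ltW.
- case=> [|[|[|[|[|i]]]]] //= _; rewrite /x /=.
  + by rewrite mulrBl; lra.
  + by move: dec2; rewrite -e2; lra.
  + by move: dec3; rewrite -e3; lra.
  + by rewrite !mulNr mulrBl; lra.
- case=> [|[|[|[|[|i]]]]] //= _; rewrite !big_ord_recr big_ord0 /= add0r /x /= ?card0 ?card1 ?card2 ?card3 ?card4 -/cc -/ee -/nn0 -/nn4.
  + by ring.
  + by rewrite mulr1 e2; ring.
  + rewrite mul1r e3 !mul1r.
    have -> : nn0 * (cc * s0) + cc * ((cc - mu) * s0) + g = t * ee * (nn4 + ee - mu).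
      by rewrite -bal; ring.
    by ring.
  + rewrite !mul1r.
    have -> : nn0 * (cc * s0) + cc * ((cc - mu) * s0) + g = t * ee * (nn4 + ee - mu).
      by rewrite -bal; ring.
    by ring.
- rewrite !big_ord_recr big_ord0 /= add0r /x /= ?card0 ?card1 ?card2 ?card3 ?card4 -/cc -/ee -/nn0 -/nn4.
  rewrite !mul1r.
  have -> : nn0 * (cc * s0) + cc * ((cc - mu) * s0) + g = t * ee * (nn4 + ee - mu).
    by rewrite -bal; ring.
  by ring.
Qed.

End Model.

(** * Sides of a cut vertex *)

(* [S] is a union of components of [G - u]. *)
Definition side (G : sgraph) (S : {set G}) (u : G) : Prop :=
  u \notin S /\ forall x y : G, x \in S -> adj x y -> (y \in S) || (y == u).

Definition nbrs_in (G : sgraph) (u : G) (S : {set G}) : {set G} :=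
  [set x in S | adj u x].

Definition complete_side (G : sgraph) (S : {set G}) (u : G) : Prop :=
  {in nbrs_in u S & S :\: nbrs_in u S, forall x y, adj x y}.

Section Side.
Local Open Scope ring_scope.
Variables (R : realType) (G : sgraph) (S : {set G}) (u : G).
Hypothesis sideS : side S u.
Local Notation S1 := (nbrs_in u S).
Local Notation S0 := (S :\: S1).

Lemma sum_side (F : G -> R) :
  \sum_(x in S) F x = \sum_(x in S0) F x + \sum_(x in S1) F x.
Proof.
rewrite (bigID (mem S1)) /= addrC; congr (_ + _); apply: eq_bigl => x.
  by rewrite in_setD andbC.
by rewrite inE; case: (x \in S).
Qed.

Variables (f : G -> R) (al0 al1 g mu : R) (n0 : nat).
Hypothesis f0 : {in S0, forall x, f x = al0}.
Hypothesis f1 : {in S1, forall x, f x = al1}.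
Hypothesis fu : f u = g.

(** The number of edges between the two cells, counted from [S1]; [E_swap] counts them from [S0]. *)
Let E : R := \sum_(x in S1) #|[set y in S0 | adj x y]|%:R.

Let lap0 x : x \in S0 -> lap f x = (al0 - al1) * #|[set y in S1 | adj x y]|%:R.
Proof.
move=> xS0; have xS : x \in S by move: xS0; rewrite inE => /andP[].
rewrite /lap f0 // (bigID (mem S1)) /= [X in _ + X]big1 ?addr0 => [|y /andP[xy yS1]].
  rewrite (eq_bigr (fun=> al0 - al1)) => [|y /andP[_ /f1->]] //.
  rewrite sumr_const mulr_natr; congr (_ *+ _); apply: eq_card => y.
  by rewrite unfold_in !inE; case: (adj x y); rewrite ?andbT ?andbF.
have /orP[yS|/eqP yu] := sideS.2 x y xS xy.
  by rewrite f0 ?subrr // inE yS1.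
move: xS0; rewrite !inE xS /=.
by rewrite -yu adj_sym xy.
Qed.

Let lap1 x : x \in S1 ->
  lap f x = (al1 - al0) * #|[set y in S0 | adj x y]|%:R + (al1 - g).
Proof.
move=> xS1; have [xS ux] : x \in S /\ adj u x by move: xS1; rewrite inE => /andP[].
rewrite /lap f1 // (bigD1 u) /=; last by rewrite adj_sym.
rewrite fu addrC; congr (_ + _).
rewrite (bigID (mem S1)) /= big1 ?add0r => [|y /andP[_ /f1 ->]]; last by rewrite subrr.
rewrite (eq_bigr (fun=> al1 - al0)) => [|y /andP[/andP[xy yu] yS1]]; last first.
  rewrite f0 // inE yS1 /=.
  by have /orP[//|] := sideS.2 x y xS xy; rewrite (negPf yu).
rewrite sumr_const mulr_natr; congr (_ *+ _); apply: eq_card => y.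
rewrite unfold_in !inE; case xy: (adj x y) => /=; last by rewrite andbF.
rewrite andbT; case yS: (y \in S) => /=.
  rewrite andbT; case: eqP => [yu|//].
  by case: sideS; rewrite -yu yS.
by have /orP[|/eqP->] := sideS.2 x y xS xy; rewrite ?yS // eqxx.
Qed.

Let E_swap : \sum_(x in S0) #|[set y in S1 | adj x y]|%:R = E.
Proof.
rewrite /E -!natr_sum; congr _%:R.
under eq_bigr do rewrite -sum1_card.
rewrite (exchange_big_dep (mem S1)) /=; last by move=> x y _; rewrite inE => /andP[].
apply: eq_bigr => y yS1; rewrite sum1_card; apply: eq_card => x.
by rewrite unfold_in /= 2!inE yS1 adj_sym; case: (x \in S0).
Qed.

Let E_le : E <= #|S1|%:R * #|S0|%:R.
Proof.
rewrite mulr_natl -sumr_const; apply: ler_sum => x _; rewrite ler_nat.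
by apply: subset_leq_card; apply/subsetP => y; rewrite inE => /andP[].
Qed.

Let side_sumE : \sum_(x in S) f x * (lap f x - mu * f x) =
  E * (al0 - al1) ^+ 2 + #|S1|%:R * al1 * (al1 - g)
  - mu * (#|S0|%:R * al0 ^+ 2 + #|S1|%:R * al1 ^+ 2).
Proof.
rewrite sum_side.
rewrite (eq_bigr (fun x => al0 * (al0 - al1) * #|[set y in S1 | adj x y]|%:R
  + (- mu * al0 ^+ 2))) => [|x xS]; last by rewrite lap0 // f0 //; ring.
rewrite [X in _ + X](eq_bigr (fun x => al1 * (al1 - al0) * #|[set y in S0 | adj x y]|%:R
  + (al1 * (al1 - g) - mu * al1 ^+ 2))) => [|x xS]; last by rewrite lap1 // f1 //; ring.
rewrite big_split [X in _ + X]big_split !sumr_const /= -!mulr_sumr E_swap -/E.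
rewrite -[X in _ + X + _ = _]mulr_natl -[X in _ + (_ + X) = _]mulr_natl.
by ring.
Qed.

(** The equations are those of a side with exactly [n0] outer vertices, all joined to [S1], for
    which the sum is 0. Every further outer vertex and every missing edge between the cells lowers
    the sum by a positive amount, whence the sign and the equality case. *)
Lemma side_sum : n0%:R * (al1 - al0) + (al1 - g) = mu * al1 ->
  #|S1|%:R * (al0 - al1) = mu * al0 ->
  0 < mu -> mu < 1 -> (0 < #|S1|)%N -> al0 != 0 -> (n0 + #|S1| <= #|S|)%N ->
  \sum_(x in S) f x * (lap f x - mu * f x) <= 0 /\
  (\sum_(x in S) f x * (lap f x - mu * f x) = 0 ->
    #|S| = (n0 + #|S1|)%N /\ complete_side S u).
Proof.
move=> eq1 eq0 mu0 mu1 c0 al0n0 cardS.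
have S1S : S1 \subset S by apply/subsetP => x; rewrite inE => /andP[].
have cardE : #|S| = (#|S0| + #|S1|)%N.
  by rewrite addnC -(cardsID S1 S) (setIidPr S1S).
have [k S0E] : exists k, #|S0| = (n0 + k)%N by exists (#|S0| - n0)%N; lia.
rewrite side_sumE.
have cr : 1 <= #|S1|%:R :> R by rewrite ler1n.
have Ele := E_le; set c : R := #|S1|%:R in cr eq0 Ele *.
have gE : al1 - g = mu * al1 + n0%:R * (al0 - al1) by rewrite -eq1; ring.
have al1E : al1 = al0 - mu * al0 / c.
  by rewrite -eq0 mulrC mulKf; [ring|rewrite gt_eqF //; lra].
(* [k] counts the surplus outer vertices and [c * #|S0|%:R - E] the missing edges. *)
have -> : E * (al0 - al1) ^+ 2 + c * al1 * (al1 - g)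
  - mu * (#|S0|%:R * al0 ^+ 2 + c * al1 ^+ 2) =
  - (k%:R * (mu * (al0 ^+ 2 * (1 - mu / c)))
     + (c * #|S0|%:R - E) * (mu * al0 / c) ^+ 2).
  rewrite gE al1E S0E natrD; field.
  by rewrite gt_eqF //; lra.
have pos1 : 0 < mu * (al0 ^+ 2 * (1 - mu / c)).
  rewrite mulr_gt0 // mulr_gt0 //; first by rewrite exprn_even_gt0.
  rewrite subr_gt0 ltr_pdivrMr; lra.
have pos2 : 0 < (mu * al0 / c) ^+ 2.
  rewrite exprn_even_gt0 //= mulf_neq0 ?mulf_neq0 ?invr_neq0 // gt_eqF //; lra.
have ge1 : 0 <= k%:R * (mu * (al0 ^+ 2 * (1 - mu / c))).
  by rewrite mulr_ge0 // ltW.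
have ge2 : 0 <= (c * #|S0|%:R - E) * (mu * al0 / c) ^+ 2.
  by rewrite mulr_ge0 ?subr_ge0 // ltW.
split; first by rewrite oppr_le0 addr_ge0.
move=> /eqP; rewrite oppr_eq0 paddr_eq0 // => /andP[].
rewrite mulf_eq0 (gt_eqF pos1) orbF => k0; rewrite mulf_eq0 (gt_eqF pos2) orbF => E0.
split.
  by move: k0; rewrite pnatr_eq0 => /eqP k0; rewrite cardE S0E k0 addn0.
have EE : c * #|S0|%:R - E = \sum_(x in S1) (#|S0|%:R - #|[set y in S0 | adj x y]|%:R).
  by rewrite sumrB sumr_const mulr_natl.
move: E0; rewrite EE psumr_eq0 => [/allP H|x _]; last first.
  rewrite subr_ge0 ler_nat; apply: subset_leq_card; apply/subsetP => y.
  by rewrite inE => /andP[].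
move=> x y xS1 yS0; have := H x (mem_index_enum _); rewrite xS1 /=.
rewrite subr_eq0 eqr_nat => /eqP e.
have sub : [set y in S0 | adj x y] \subset S0.
  by apply/subsetP => z; rewrite inE => /andP[].
have /eqP eqS : [set y in S0 | adj x y] == S0 by rewrite eqEcard sub e leqnn.
by move: yS0; rewrite -eqS inE => /andP[].
Qed.

End Side.

(** * Lower bound for the second eigenvalue at a cut vertex *)

Section CutBound.
Local Open Scope ring_scope.

(** The path eigenvector of [gap_vector], carried over to [G], is the test function of
    [two_part_lambda2], and [side_sum] controls each side. *)
Lemma cut_lambda2 (R : realType) (G : sgraph) (d n0 n4 : nat) (A B : {set G}) (v : G)
    (c := #|nbrs_in v A|) (e := #|nbrs_in v B|) (mu : R) :
  regular d G -> side A v -> side B v -> B = ~: (v |: A) ->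
  (0 < c)%N -> (0 < e)%N -> (c + e = d)%N ->
  (n0 + c <= #|A|)%N -> (n4 + e <= #|B|)%N -> 0 < mu -> mu < 1 ->
  gap_poly (n0 + c)%:R (n4 + e)%:R (c%:R + e%:R) (c%:R * e%:R) mu = 0 ->
  d%:R - mu <= lambda2 R G /\
  (lambda2 R G <= d%:R - mu ->
    [/\ #|A| = (n0 + c)%N, complete_side A v,
        #|B| = (n4 + e)%N & complete_side B v]).
Proof.
move=> dreg sA sB BE c0 e0 ce nA nB mu0 mu1 gap.
have cr : 1 <= c%:R :> R by rewrite ler1n.
have er : 1 <= e%:R :> R by rewrite ler1n.
have n0r : 0 <= n0%:R :> R by rewrite ler0n.
have n4r : 0 <= n4%:R :> R by rewrite ler0n.
have [|||| s [t [g [sp tp gA gB bal]]]] := gap_vector _ _ _ _ mu0 mu1 gap; try by rewrite ?natrD; lra.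
rewrite !natrD in gA gB bal.
have vA : v \notin A := sA.1.
have vB : v \notin B := sB.1.
have BA x : x \in B -> x \notin A by rewrite BE !inE negb_or => /andP[].
have inB x : x != v -> x \notin A -> x \in B.
  by rewrite BE !inE negb_or => -> ->.
pose f x : R := if x == v then g else if x \in A then
    (if adj v x then (c%:R - mu) * s else c%:R * s)
  else (if adj v x then - (e%:R - mu) * t else - e%:R * t).
have neqA x : x \in A -> x == v = false by move=> xA; apply/eqP => xv; rewrite -xv xA in vA.
have neqB x : x \in B -> x == v = false by move=> xB; apply/eqP => xv; rewrite -xv xB in vB.
have fA0 : {in A :\: nbrs_in v A, forall x, f x = c%:R * s}.
  by move=> x; rewrite !inE => /andP[nx xA]; rewrite /f neqA // xA; move: nx; rewrite xA /= => /negPf ->.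
have fA1 : {in nbrs_in v A, forall x, f x = (c%:R - mu) * s}.
  by move=> x; rewrite !inE => /andP[xA nx]; rewrite /f neqA // xA nx.
have fB0 : {in B :\: nbrs_in v B, forall x, f x = - e%:R * t}.
  move=> x; rewrite !inE => /andP[nx xB]; rewrite /f neqB // (negPf (BA _ xB)).
  by move: nx; rewrite xB /= => /negPf ->.
have fB1 : {in nbrs_in v B, forall x, f x = - (e%:R - mu) * t}.
  by move=> x; rewrite !inE => /andP[xB nx]; rewrite /f neqB // (negPf (BA _ xB)) nx.
have fv : f v = g by rewrite /f eqxx.
have sD : mu * (s * (n0%:R + c%:R - mu)) = (c%:R - mu) * s - g by rewrite gA; ring.
have tD : mu * (t * (n4%:R + e%:R - mu)) = g - - (e%:R - mu) * t by rewrite gB; ring.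
(* The numbers of neighbours of [v] in the two sides are those of the model, so the eigenvector
   equation holds at [v], which contributes nothing to the sums. *)
have lapv : lap f v = mu * f v.
  rewrite /lap fv.
  have -> : \sum_(y | adj v y) (g - f y) =
      \sum_(y in nbrs_in v A) (g - f y) + \sum_(y in nbrs_in v B) (g - f y).
    rewrite (bigID (mem A)) /=; congr (_ + _); apply: eq_bigl => x.
      by rewrite !inE andbC.
    rewrite BE !inE; case vx: (adj v x) => //=; last by rewrite andbF.
    rewrite andbT negb_or andbC; case: eqP => //= xv; last by rewrite andbT.
    by rewrite xv adj_irr in vx.
  rewrite (eq_bigr (fun=> g - (c%:R - mu) * s)) => [|x /fA1 ->] //.
  rewrite [X in _ + X](eq_bigr (fun=> g - (- (e%:R - mu) * t))) => [|x /fB1 ->] //.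
  rewrite !sumr_const -/c -/e -tD -[g - _]opprB -sD.
  rewrite -[X in X + _ = _]mulr_natl -[X in _ + X = _]mulr_natl.
  have -> : g = t * e%:R * (n4%:R + e%:R - mu) - s * c%:R * (n0%:R + c%:R - mu).
    by rewrite -bal; ring.
  by ring.
have [sumA sumA0] : \sum_(x in A) f x * (lap f x - mu * f x) <= 0 /\
  (\sum_(x in A) f x * (lap f x - mu * f x) = 0 ->
    #|A| = (n0 + c)%N /\ complete_side A v).
  apply: (side_sum sA fA0 fA1 fv) => //.
  - by rewrite gA; ring.
  - by rewrite -/c; ring.
  - by rewrite mulf_neq0 // gt_eqF //; lra.
have [sumB sumB0] : \sum_(x in B) f x * (lap f x - mu * f x) <= 0 /\
  (\sum_(x in B) f x * (lap f x - mu * f x) = 0 ->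
    #|B| = (n4 + e)%N /\ complete_side B v).
  apply: (side_sum sB fB0 fB1 fv) => //.
  - by rewrite gB; ring.
  - by rewrite -/e; ring.
  - by rewrite mulf_neq0 ?oppr_eq0 // gt_eqF //; lra.
have G1 : (1 < #|G|)%N.
  case/card_gt0P: c0 => x; rewrite inE => /andP[xA _].
  rewrite (cardD1 v) (cardD1 x) !inE; case: eqP => // xv.
  by rewrite -xv xA in vA.
have fApos x : x \in A -> 0 < f x.
  by move=> xA; rewrite /f neqA // xA; case: ifP => _; apply: mulr_gt0 => //; lra.
have fBneg x : x \in B -> f x < 0.
  by move=> xB; rewrite /f neqB // (negPf (BA _ xB)); case: ifP => _; rewrite mulNr oppr_lt0; apply: mulr_gt0 => //; lra.
have sfA : 0 < \sum_(x in A) f x.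
  case/card_gt0P: c0 => x; rewrite inE => /andP[xA _]; rewrite (bigD1 x) //=.
  rewrite ltr_pwDl ?fApos //; apply: sumr_ge0 => y /andP[yA _]; exact: ltW (fApos _ yA).
have sfB : \sum_(x in B) f x < 0.
  case/card_gt0P: e0 => x; rewrite inE => /andP[xB _]; rewrite (bigD1 x) //=.
  have := fBneg _ xB; have : \sum_(y in B | y != x) f y <= 0.
    by apply: sumr_le0 => y /andP[yB _]; exact: ltW (fBneg _ yB).
  by lra.
have vterm : f v * (lap f v - mu * f v) = 0 by rewrite lapv subrr mulr0.
(* The sign of [g] decides which part receives [v]. *)
have [g0|g0] := leP 0 g.
- have CX : ~: (v |: A) = B by rewrite BE.
  have [||||||le eq] := @two_part_lambda2 R G d f (v |: A) mu dreg G1.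
  + move=> x; rewrite !inE => /orP[/eqP->|/fApos/ltW //]; by rewrite fv.
  + by move=> x; rewrite CX => /fBneg/ltW.
  + by rewrite big_setU1 //= fv; lra.
  + by rewrite CX.
  + by rewrite big_setU1 //= vterm add0r.
  + by rewrite CX.
  split=> // /eq [] ; rewrite big_setU1 //= vterm add0r CX.
  by move=> /sumA0[-> ?] /sumB0[-> ?].
- have CX : ~: A = v |: B.
    by apply/setP => x; rewrite BE !inE; case: eqP => [->|].
  have [||||||le eq] := @two_part_lambda2 R G d f A mu dreg G1.
  + by move=> x /fApos/ltW.
  + by move=> x; rewrite CX !inE => /orP[/eqP->|/fBneg/ltW //]; rewrite fv ltW.
  + by [].
  + by rewrite CX big_setU1 //= fv; lra.
  + by [].
  + by rewrite CX big_setU1 //= vterm add0r.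
  split=> // /eq []; rewrite CX big_setU1 //= vterm add0r.
  by move=> /sumA0[-> ?] /sumB0[-> ?].
Qed.

End CutBound.

(** * From connectivity below 2 to a cut vertex *)

Lemma card_delete (G : sgraph) (S : {set G}) : #|delete S| = #|~: S|.
Proof. by rewrite card_sig cardsE; apply: eq_card => x; rewrite !inE. Qed.

Lemma closed_connected (G : sgraph) (A : {set G}) (x y : G) : connected G ->
  (forall z w, z \in A -> adj z w -> w \in A) -> x \in A -> y \in A.
Proof.
case/andP=> _ /forallP/(_ x)/forallP/(_ y)/connectP[p].
elim: p x => [|z p IH] x /= => [_ -> //|/andP[xz zp] ylast cl xA].
by apply: (IH z zp ylast cl); apply: cl xz.
Qed.

(** A separating set of size at most one leaves at least three vertices, so it really disconnects.
    [A] is a component of what remains; the empty set is excluded by connectivity, and a side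
    without neighbours of [v] would be closed under adjacency in [G]. *)
Lemma kappa_lt2_cut_vertex (G : sgraph) : connected G -> 3 < #|G| -> kappa G < 2 ->
  exists (v : G) (A : {set G}), let B := ~: (v |: A) in
  [/\ side A v, side B v, 0 < #|nbrs_in v A| & 0 < #|nbrs_in v B|].
Proof.
move=> conn G4; rewrite /kappa; case: arg_minnP => [|S sepS _ S2].
  by rewrite /separating card_delete setCT cards0.
have cardC : #|~: S| = #|G| - #|S| by rewrite -(cardsC S) addKn.
move: sepS; rewrite /separating leqNgt card_delete cardC.
have -> /= : 1 < #|G| - #|S| by lia.
rewrite /connected negb_and card_delete cardC.
have -> /= : 0 < #|G| - #|S| by lia.
rewrite negb_forall => /existsP[x]; rewrite negb_forall => /existsP[y nxy].
pose A := [set val z | z in connect (@delete_adj G S) x].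
have Acl z w : z \in A -> adj z w -> (w \in A) || (w \in S).
  case/imsetP=> z' xz' ->{z} zw; have [//|wS] := boolP (w \in S); first by rewrite orbT.
  rewrite orbF; apply/imsetP; exists (exist _ w wS) => //.
  by rewrite inE; apply: connect_trans xz' (connect1 _).
have xA : val x \in A by apply/imsetP; exists x; rewrite // inE; apply: connect0.
have yA : val y \notin A.
  by apply/imsetP => -[z xz] /val_inj yz; case/negP: nxy; rewrite yz.
have AS z : z \in A -> z \notin S by case/imsetP=> z' _ ->; exact: (svalP z').
have [S0|[v Sv]] : S = set0 \/ exists v, S = [set v].
  case: (posnP #|S|) => [/cards0_eq ->|S1]; first by left.
  by right; apply/cards1P; rewrite eqn_leq S1 andbT -ltnS.
  case/negP: yA; apply: closed_connected xA => // z w zA zw.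
  by have := Acl z w zA zw; rewrite S0 in_set0 orbF.
have vA : v \notin A by apply/negP => /AS; rewrite Sv set11.
have vB : v \notin ~: (v |: A) by rewrite !inE eqxx.
have sA : side A v.
  by split=> // z w zA zw; have := Acl z w zA zw; rewrite Sv inE.
have sB : side (~: (v |: A)) v.
  split=> // z w; rewrite !inE !negb_or => /andP[zv zA] zw.
  case: eqP => //= wv; rewrite orbF; apply/negP => wA.
  have := Acl w z wA; rewrite adj_sym => /(_ zw).
  by rewrite (negPf zA) Sv inE (negPf zv).
exists v, A; split => //.
- rewrite lt0n; apply/eqP => /cards0_eq e.
  case/negP: yA; apply: closed_connected xA => // z w zA zw.
  have /orP[//|/eqP wv] := sA.2 z w zA zw.
  have : z \in nbrs_in v A by rewrite inE zA -wv adj_sym.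
  by rewrite e inE.
- rewrite lt0n; apply/eqP => /cards0_eq e.
  have yB : val y \in ~: (v |: A).
    have vS z : z \notin S -> z != v by rewrite Sv inE.
    by rewrite !inE negb_or yA andbT; apply/vS/(svalP y).
  suff : val x \in ~: (v |: A) by rewrite !inE negb_or xA andbF.
  apply: closed_connected yB => // z w zB zw.
  have /orP[//|/eqP wv] := sB.2 z w zB zw.
  have : z \in nbrs_in v (~: (v |: A)) by rewrite inE zB -wv adj_sym.
  by rewrite e inE.
Qed.

(** With vertices ordered by [enum_rank], each edge is counted once forwards and once backwards. *)
Lemma handshake (T : finType) (r : rel T) (S : {set T}) :
  symmetric r -> irreflexive r ->
  ~~ odd (\sum_(x in S) #|[set y in S | r x y]|).
Proof.
move=> rsym rirr.
pose lt (x y : T) := enum_rank x < enum_rank y.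
pose K := \sum_(x in S) \sum_(y in S) (r x y && lt x y : nat).
have -> : \sum_(x in S) #|[set y in S | r x y]| = K + K.
  have KE : K = \sum_(x in S) \sum_(y in S) (r x y && lt y x).
    rewrite /K exchange_big /=; apply: eq_bigr => x _; apply: eq_bigr => y _.
    by rewrite rsym.
  rewrite {2}KE -big_split; apply: eq_bigr => x xS /=; rewrite -big_split /=.
  rewrite -sum1_card big_mkcond [RHS]big_mkcond; apply: eq_bigr => y _.
  rewrite inE; case: (y \in S) => //=; case rxy: (r x y) => //=.
  rewrite /lt; case: (ltngtP (enum_rank x) (enum_rank y)) => // e.
  by move: rxy; rewrite (enum_rank_inj (ord_inj e)) rirr.
by rewrite addnn odd_double.
Qed.

(** Neighbours in the complement of the graph induced on [T]: cells are recognised through their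
    complements, which have degree 0, 1 or 2. *)
Definition conbrs (G : sgraph) (T : {set G}) (x : G) : {set G} :=
  [set y in T | compl_adj x y].

Section RegularSide.
Variables (G : sgraph) (d : nat) (S : {set G}) (u : G).
Hypotheses (dreg : regular d G) (sideS : side S u).
Local Notation S1 := (nbrs_in u S).
Local Notation S0 := (S :\: S1).

Lemma side_degree x : x \in S -> #|[set y in S | adj x y]| + adj u x = d.
Proof.
move=> xS; rewrite -(dreg x) -(cardsID S [set y | adj x y]); congr (_ + _).
  by apply: eq_card => y; rewrite !inE andbC.
have sub y : y \in [set y | adj x y] :\: S -> y = u.
  rewrite !inE => /andP[yS xy].
  by have := sideS.2 x y xS xy; rewrite (negPf yS) => /eqP.
case ux: (adj u x).
  rewrite (_ : _ :\: _ = [set u]) ?cards1 //; apply/setP => y; rewrite inE.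
  apply/idP/eqP => [/sub//|->]; by rewrite !inE adj_sym ux sideS.1.
apply/esym/eqP; rewrite cards_eq0; apply/eqP/setP => y; rewrite [RHS]inE.
apply/negP => yS; move: (yS); rewrite (sub _ yS) !inE adj_sym ux.
by rewrite andbF.
Qed.

(** A vertex of [S] not adjacent to [u] has its [d] neighbours in [S]. One exists: if [u] were
    adjacent to all of [S], a vertex of [S] would have fewer than [#|S1|] neighbours in [S], hence
    degree at most [#|S1| < d]. *)
Lemma side_card : 0 < #|S1| < d -> d + 1 <= #|S|.
Proof.
case/andP=> c0 cd.
have [x xS nux] : exists2 x, x \in S & ~~ adj u x.
  apply/exists_inP; apply: contraTT c0 => /exists_inPn all; rewrite -leqNgt leqn0.
  apply/negPn/negP; rewrite -lt0n => /card_gt0P[x]; rewrite inE => /andP[xS ux].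
  have := side_degree xS; rewrite ux.
  have : #|[set y in S | adj x y]| < #|S1|.
    apply: proper_card; apply/properP; split.
      by apply/subsetP => y; rewrite !inE => /andP[yS _]; rewrite yS; have := all y yS; rewrite negbK.
    by exists x; rewrite !inE ?xS ?adj_irr.
  by lia.
have := side_degree xS; rewrite (negPf nux) addn0 => <-.
have : #|[set y in S | adj x y]| < #|S|.
  apply: proper_card; apply/properP; split.
    by apply/subsetP => y; rewrite inE => /andP[].
  by exists x; rewrite ?inE ?xS ?adj_irr.
by lia.
Qed.

(** In the sum of the degrees over [S], edges inside [S] count twice and [#|S1|] edges go to [u]. *)
Lemma side_parity : odd (d * #|S|) = odd #|S1|.
Proof.
have : \sum_(x in S) (#|[set y in S | adj x y]| + adj u x) = d * #|S|.
  by rewrite (eq_bigr (fun=> d)) => [|x /side_degree //]; rewrite sum_nat_const mulnC.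
rewrite big_split /= => <-.
rewrite oddD (negPf (handshake _ (@adj_sym G) (@adj_irr G))) /=.
congr odd; rewrite -sum1_card big_mkcond [RHS]big_mkcond; apply: eq_bigr => x _.
by rewrite inE; case: (x \in S); case: (adj u x).
Qed.

Variable k : nat.
Hypotheses (compS : complete_side S u) (cardS : #|S| = d + k).

Lemma card_conbrs (T : {set G}) x : x \in T ->
  #|conbrs T x| + #|[set y in T | adj x y]| + 1 = #|T|.
Proof.
move=> xT; rewrite (cardsD1 x T) xT addnC; congr (_ + _).
rewrite -(cardsID [set y | adj x y] (T :\ x)) addnC; congr (_ + _); apply: eq_card => y.
  rewrite !inE; case: eqVneq => [->|] /=; last by [].
  by rewrite adj_irr andbF.
by rewrite !inE /compl_adj [x == y]eq_sym; case: (y == x); case: (adj x y); case: (y \in T).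
Qed.

Let cardS01 : #|S0| + #|S1| = #|S|.
Proof.
rewrite addnC -(cardsID S1 S); congr (_ + _); apply: eq_card => x.
by rewrite !inE; case: (x \in S).
Qed.

Let degsplit x : #|[set y in S | adj x y]| =
  #|[set y in S1 | adj x y]| + #|[set y in S0 | adj x y]|.
Proof.
rewrite -(cardsID S1 [set y in S | adj x y]); congr (_ + _); apply: eq_card => y.
  by rewrite !inE; case: (y \in S); case: (adj u y); case: (adj x y).
by rewrite !inE; case: (y \in S); case: (adj u y); case: (adj x y).
Qed.

(** All [d] neighbours of [x] lie in [S], among them all of [S1], so [k] vertices of [S0] are left,
    [x] included. In [conbrs_inner] one neighbour is [u], which raises the count by one. *)
Lemma conbrs_outer x : x \in S0 -> #|conbrs S0 x| + 1 = k.
Proof.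
move=> xS0; have [xS nx] : x \in S /\ ~~ adj u x.
  by move: xS0; rewrite !inE; case: (x \in S) => //; rewrite andbT.
have := side_degree xS; rewrite (negPf nx) addn0 degsplit.
have -> : [set y in S1 | adj x y] = S1.
  apply/setP => y; rewrite inE; case yS1: (y \in S1) => //=.
  by rewrite adj_sym; apply: compS.
by have := card_conbrs xS0; have := cardS01; lia.
Qed.

Lemma conbrs_inner x : x \in S1 -> #|conbrs S1 x| = k.
Proof.
move=> xS1; have [xS ux] : x \in S /\ adj u x by move: xS1; rewrite !inE => /andP.
have := side_degree xS; rewrite ux degsplit.
have -> : [set y in S0 | adj x y] = S0.
  apply/setP => y; rewrite inE; case yS0: (y \in S0) => //=.
  exact: compS.
by have := card_conbrs xS1; have := cardS01; lia.
Qed.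

End RegularSide.

(** * Recognising sequential joins *)

(** An isomorphism of [T] with the induced subgraph on [S]. The relation is a parameter so that
    complements can be recognised by [compl_adj] and transferred by [embeds_compl]. *)
Definition embeds (T : sgraph) (V : finType) (r : rel V) (S : {set V}) : Prop :=
  exists phi : T -> V, [/\ injective phi, forall y, (y \in S) = (y \in codom phi)
    & forall x y, r (phi x) (phi y) = adj x y].

Lemma embeds_compl (T G : sgraph) (S : {set G}) :
  embeds T (@compl_adj G) S -> embeds (compl T) (@adj G) S.
Proof.
case=> phi [inj cod adjE]; exists phi; split=> // x y /=.
change (adj (phi x) (phi y) = compl_adj (G := T) x y).
rewrite /compl_adj -adjE /compl_adj (inj_eq inj) negb_and !negbK.
by case: eqVneq => [->|]; rewrite ?adj_irr.
Qed.

Lemma mem_codom_tnth (V : finType) (p : seq V) y :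
  (y \in codom (tnth (in_tuple p))) = (y \in p).
Proof.
apply/codomP/idP => [[i ->]|yp]; first exact: (mem_tnth i (in_tuple p)).
have ip : index y p < size p by rewrite index_mem.
by exists (Ordinal ip); rewrite (tnth_nth y) /= nth_index.
Qed.

Lemma embeds_complete (G : sgraph) (S : {set G}) n : #|S| = n ->
  {in S &, forall x y, x != y -> adj x y} -> embeds (complete n) (@adj G) S.
Proof.
move=> <- adjS; exists (fun i => enum_val i); split; first exact: enum_val_inj.
  move=> y; apply/idP/codomP => [yS|[i ->]]; last exact: enum_valP.
  by exists (enum_rank_in yS y); rewrite enum_rankK_in.
move=> i j; change (adj (enum_val i) (enum_val j) = (i != j)).
case: (eqVneq i j) => [->|ij]; first by rewrite adj_irr.
by rewrite adjS ?enum_valP // (inj_eq enum_val_inj).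
Qed.

Section RegularRelations.
Variables (V : finType) (r : rel V).
Hypotheses (rsym : symmetric r) (rirr : irreflexive r).

(** Partners are listed side by side, at positions [2k] and [2k + 1], as in [matching]. The
    induction removes one edge; the other vertices keep their partners. *)
Lemma matching_seq (S : {set V}) :
  {in S, forall x, #|[set y in S | r x y]| = 1} ->
  exists p : seq V, [/\ uniq p, p =i S & forall x0 i j, i < size p -> j < size p ->
    r (nth x0 p i) (nth x0 p j) = (i != j) && (i./2 == j./2)].
Proof.
move: {2}#|S| (leqnn #|S|) => n; elim: n S => [|n IH] S.
  rewrite leqn0 cards_eq0 => /eqP -> _; exists [::]; split => // x.
  by rewrite inE.
move=> cardS reg1; case: (set_0Vmem S) => [->|[x xS]].
  by exists [::]; split => // x; rewrite inE.
have /eqP/cards1P[y Nx] := reg1 x xS.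
have nbrx z : z \in S -> r x z = (z == y).
  by move=> zS; have /setP/(_ z) := Nx; rewrite !inE zS.
have [yS rxy] : y \in S /\ r x y.
  by have /setP/(_ y) := Nx; rewrite !inE eqxx => /andP.
have nbry z : z \in S -> r y z = (z == x).
  move=> zS; have /eqP/cards1P[w Ny] := reg1 y yS.
  have /setP/(_ z) := Ny; have /setP/(_ x) := Ny.
  by rewrite !inE zS xS (rsym y x) rxy /= => /esym/eqP <-.
have yx : y != x by apply: contraTneq rxy => ->; rewrite rirr.
pose S' := S :\: [set x; y].
have S'P z : (z \in S') = [&& z != x, z != y & z \in S].
  by rewrite !inE negb_or andbA.
have [|z|p [up pS' adjp]] := IH S'.
- rewrite -ltnS; apply: leq_trans cardS; apply: proper_card.
  apply/properP; split; first by apply/subsetP => z; rewrite S'P => /and3P[].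
  by exists x => //; rewrite S'P eqxx.
- rewrite S'P => /and3P[zx zy zS]; rewrite -(reg1 z zS); apply: eq_card => w.
  rewrite !inE; case wS: (w \in S); rewrite ?andbF //= andbT.
  case rzw: (r z w); rewrite ?andbF // andbT.
  apply/norP; split; apply: contraTneq rzw => ->; rewrite rsym.
    by rewrite nbrx // zy.
  by rewrite nbry // zx.
have xp : x \notin p by rewrite pS' S'P eqxx.
have yp : y \notin p by rewrite pS' S'P eqxx andbF.
exists [:: x, y & p]; split.
- by rewrite /= inE negb_or eq_sym yx xp yp up.
- move=> z; rewrite !inE pS' S'P.
  case: (eqVneq z x) => [->|_] /=; first by rewrite xS.
  by case: (eqVneq z y) => [->|_] /=; first by rewrite yS.
have inS x0 i : i < size p -> nth x0 p i \in S.
  by move=> ip; have := mem_nth x0 ip; rewrite pS' S'P => /and3P[].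
have neqx x0 i : i < size p -> (nth x0 p i == x) = false.
  by move=> ip; have := mem_nth x0 ip; rewrite pS' S'P => /and3P[/negPf].
have neqy x0 i : i < size p -> (nth x0 p i == y) = false.
  by move=> ip; have := mem_nth x0 ip; rewrite pS' S'P => /and3P[_ /negPf].
move=> x0 [|[|i]] [|[|j]] /=; rewrite ?ltnS => ip jp.
- by rewrite rirr.
- by rewrite nbrx ?eqxx.
- by rewrite nbrx ?inS ?neqy.
- by rewrite nbry ?eqxx.
- by rewrite rirr.
- by rewrite nbry ?inS ?neqx.
- by rewrite rsym nbrx ?inS ?neqy.
- by rewrite rsym nbry ?inS ?neqx.
- by rewrite adjp.
Qed.

Lemma embeds_matching (S : {set V}) n : #|S| = n ->
  {in S, forall x, #|[set y in S | r x y]| = 1} -> embeds (matching n) r S.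
Proof.
move=> cardS /matching_seq[p [up pS adjp]].
have {cardS} <- : size p = n by rewrite -cardS -(card_uniqP up); apply: eq_card.
exists (tnth (in_tuple p)); split.
- by exact/tuple_uniqP.
- by move=> y; rewrite mem_codom_tnth pS.
move=> i j; have [x0 _] : exists x0 : V, true by exists (tnth (in_tuple p) i).
by rewrite !(tnth_nth x0) /= adjp.
Qed.

Lemma next_nth_modn (p : seq V) x0 i : uniq p -> i < size p ->
  next p (nth x0 p i) = nth x0 p (i.+1 %% size p).
Proof.
case: p => [|y p] // up ip; rewrite next_nth mem_nth // index_uniq //.
move: ip; rewrite leq_eqVlt => /orP[/eqP e|ip].
  by rewrite e modnn /= nth_default //; move: e => /= [->].
by rewrite modn_small // -nth_behead; apply: set_nth_default.
Qed.

(** A path is prolonged at its head by a neighbour other than the second vertex; by finiteness it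
    meets itself and closes a cycle. *)
Lemma exists_cycle (S : {set V}) :
  {in S, forall x, #|[set y in S | r x y]| = 2} -> S != set0 ->
  exists p : seq V, [/\ uniq p, {subset p <= S}, cycle r p & 2 < size p].
Proof.
move=> reg2 /set0Pn[x xS].
have other a b : a \in S -> exists c, [/\ c \in S, r a c & c != b].
  move=> /reg2 /eqP/cards2P[y [z [yz Na]]].
  have [yS ray] : y \in S /\ r a y.
    by have /setP/(_ y) := Na; rewrite !inE eqxx => /andP.
  have [zS raz] : z \in S /\ r a z.
    by have /setP/(_ z) := Na; rewrite !inE eqxx orbT => /andP.
  have [yb|yb] := eqVneq y b; last by exists y.
  by exists z; rewrite -yb eq_sym.
(* [n] is fuel: at [n = 0] the path of [size q + 2] vertices would not fit in [S]. *)
suff main n a b q : #|S| <= n + size q -> uniq [:: a, b & q] ->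
    {subset [:: a, b & q] <= S} -> path r a (b :: q) ->
    exists p : seq V, [/\ uniq p, {subset p <= S}, cycle r p & 2 < size p].
  have [y [yS rxy yx]] := other x x xS.
  apply: (main #|S| x y [::]); rewrite ?addn0 //= ?inE ?andbT ?rxy 1?eq_sym //.
  by move=> z; rewrite !inE => /orP[/eqP->|/eqP->].
elim: n a b q => [|n IH] a b q cardS u sub pr.
  have : size [:: a, b & q] <= #|S|.
    rewrite -(card_uniqP u); apply: subset_leq_card; exact/subsetP.
  rewrite leqNgt => /negP[]; apply: leq_ltn_trans cardS _.
  by rewrite add0n ltnS leqnSn.
have aS : a \in S by apply: sub; rewrite inE eqxx.
have [c [cS rac cb]] := other a b aS.
have ca : c != a by apply: contraTneq rac => ->; rewrite rirr.
have [cq|cq] := boolP (c \in q); last first.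
  apply: (IH c a (b :: q)).
  - by rewrite /= addnS -addSn.
  - by rewrite cons_uniq u andbT !inE !negb_or ca cb.
  - by move=> z; rewrite inE => /orP[/eqP->|/sub].
  - by move: pr; rewrite /= (rsym c a) rac.
(* The path is cut just after [c]; as [c] comes beyond [a] and [b], at least three vertices are
   kept. *)
exists [:: a, b & take (index c q).+1 q].
have tE : take (index c q).+1 q = rcons (take (index c q) q) c.
  by rewrite (take_nth c) ?index_mem // nth_index.
split.
- by rewrite -[_ :: _]/(take (index c q).+3 [:: a, b & q]) take_uniq.
- by move=> z zp; apply: sub; move: zp; rewrite !inE => /or3P[->|->|/mem_take ->] //; rewrite ?orbT.
- rewrite (cycle_path a) tE /= last_rcons (rsym c a) rac /= -tE.
  by move: pr => /= /andP[rab pq]; rewrite rab /=; apply: take_path.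
- by rewrite tE /= size_rcons.
Qed.

(** On a cycle of length at least 3, successor and predecessor differ, so they exhaust the two
    neighbours. *)
Lemma cycle_nbrs (S : {set V}) (p : seq V) :
  {in S, forall x, #|[set y in S | r x y]| = 2} ->
  uniq p -> {subset p <= S} -> cycle r p -> 2 < size p ->
  {in p & S, forall x y, r x y = (y == next p x) || (y == prev p x)}.
Proof.
move=> reg2 up pS cp p3 x y xp yS.
have rn : r x (next p x) by apply: next_cycle.
have rp : r x (prev p x) by rewrite rsym; apply: prev_cycle.
have np : next p x != prev p x.
  (* Otherwise two steps forward would return to [x], so that [index x p + 2] and [index x p] would
     agree modulo the length. *)
  apply/eqP => e; have := next_prev up x; rewrite -e.
  have ip : index x p < size p by rewrite index_mem.
  have ip1 : (index x p).+1 %% size p < size p by rewrite ltn_mod; lia.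
  rewrite -[in next p x](nth_index x xp) next_nth_modn // next_nth_modn //.
  rewrite -[RHS](nth_index x xp) => /eqP; rewrite nth_uniq ?ltn_mod //; last by lia.
  have [e1|e1] : (index x p).+1 = size p \/ (index x p).+1 < size p by lia.
    by rewrite e1 modnn modn_small; lia.
  rewrite (modn_small e1).
  have [e2|e2] : (index x p).+2 = size p \/ (index x p).+2 < size p by lia.
    by rewrite e2 modnn; lia.
  by rewrite (modn_small e2); lia.
have sub : [set next p x; prev p x] \subset [set y in S | r x y].
  apply/subsetP => z; rewrite !inE => /orP[/eqP->|/eqP->].
    by rewrite rn pS ?mem_next.
  by rewrite rp pS ?mem_prev.
have /eqP/setP/(_ y) : [set next p x; prev p x] == [set y in S | r x y].
  by rewrite eqEcard sub reg2 ?pS // cards2 np.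
by rewrite !inE yS.
Qed.

(** Peel off one cycle: by [cycle_nbrs] no edge leaves it, so the rest is again 2-regular. *)
Lemma embeds_cycles (S : {set V}) :
  {in S, forall x, #|[set y in S | r x y]| = 2} ->
  exists s, [/\ all (leq 3) s, sumn s = #|S| & embeds (cycles_graph s) r S].
Proof.
move: {2}#|S| (leqnn #|S|) => n; elim: n S => [|n IH] S.
  rewrite leqn0 cards_eq0 => /eqP -> _; exists [::]; split=> //; first by rewrite cards0.
  exists (fun i : 'I_0 => False_rect _ (notF (ltn_ord i))); split=> [[]||[]] // y.
  by rewrite inE; apply/esym/negP => /codomP[[]].
move=> cardS reg2; have [S0|Sn0] := eqVneq S set0.
  rewrite S0; exists [::]; split=> //; first by rewrite cards0.
  exists (fun i : 'I_0 => False_rect _ (notF (ltn_ord i))); split=> [[]||[]] // y.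
  by rewrite inE; apply/esym/negP => /codomP[[]].
have [p [up pS cp p3]] := exists_cycle reg2 Sn0.
have nbrs := cycle_nbrs reg2 up pS cp p3.
pose S' := [set z in S | z \notin p].
have cross x y : x \in p -> y \in S' -> r x y = false.
  move=> xp; rewrite inE => /andP[yS yp]; rewrite nbrs //.
  by apply/norP; split; apply: contraNneq yp => ->; rewrite ?mem_next ?mem_prev.
have cardS' : #|S| = size p + #|S'|.
  rewrite -(card_uniqP up) -(cardsID [set z in p] S); congr (_ + _); apply: eq_card => z.
    by rewrite !inE andbC; case zp: (z \in p) => //=; apply: pS.
  by rewrite !inE andbC.
have [||s [s3 sumS' [psi [injp codp adjp]]]] := IH S'; first by lia.
  move=> x xS'; have xS : x \in S by move: xS'; rewrite inE => /andP[].
  rewrite -(reg2 x xS); apply: eq_card => y; rewrite !inE -andbA.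
  case yS: (y \in S) => //=; case yp: (y \in p) => //=.
  by rewrite rsym cross.
exists (size p :: s); split; [by rewrite /= p3 | by rewrite /= sumS' cardS' |].
pose phi (w : cycle_graph (size p) + cycles_graph s) : V :=
  match w with inl i => tnth (in_tuple p) i | inr z => psi z end.
have psiS' z : psi z \in S' by rewrite codp codom_f.
have psip z : psi z \notin p by have := psiS' z; rewrite inE => /andP[].
have inp i : tnth (in_tuple p) i \in p := mem_tnth i (in_tuple p).
have injt : injective (tnth (in_tuple p)) by exact/tuple_uniqP.
exists phi; split.
- move=> [i|z] [j|w] //= e; [by rewrite (injt _ _ e) | | |by rewrite (injp _ _ e)].
    by have := psip w; rewrite -e inp.
  by have := psip z; rewrite e inp.
- move=> y; apply/idP/codomP => [yS|[[i|z] ->]] /=; last first.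
  + by have := psiS' z; rewrite inE => /andP[].
  + exact: pS.
  have [yp|yp] := boolP (y \in p).
    have : y \in codom (tnth (in_tuple p)) by rewrite mem_codom_tnth.
    by case/codomP=> i ->; exists (inl i).
  have : y \in codom psi by rewrite -codp inE yS.
  by case/codomP=> z ->; exists (inr z).
move=> [i|z] [j|w].
- change (r (tnth (in_tuple p) i) (tnth (in_tuple p) j) = cycle_adj i j).
  rewrite /cycle_adj.
  have nextE (k : 'I_(size p)) : next p (tnth (in_tuple p) k) = tnth (in_tuple p) (ordS k).
    have [x0 _] : exists x0 : V, true by exists (tnth (in_tuple p) k).
    by rewrite !(tnth_nth x0) /= next_nth_modn.
  case: (eqVneq i j) => [->|ij] /=; first by rewrite rirr.
  rewrite nbrs ?inp ?pS // nextE (inj_eq injt); congr (_ || _).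
  by rewrite -(inj_eq (can_inj (prev_next up))) next_prev // nextE (inj_eq injt) eq_sym.
- by change (r (tnth (in_tuple p) i) (psi w) = false); rewrite cross ?inp.
- by change (r (psi z) (tnth (in_tuple p) j) = false); rewrite rsym cross ?inp.
- exact: adjp.
Qed.

End RegularRelations.

(** Embeddings chosen cell by cell give a map from the join to [G]. The last hypothesis makes the
    cells disjoint, hence the map injective; the covering makes it onto, and its inverse is the
    isomorphism. *)
Lemma iso_seqjoin (G : sgraph) (s : seq sgraph) (cell : nat -> {set G}) :
  (forall i, i < size s -> embeds (nth (complete 0) s i) (@adj G) (cell i)) ->
  (forall x, exists2 i, i < size s & x \in cell i) ->
  (forall i j x y, x \in cell i -> y \in cell j -> i != j ->
     (x != y) && (adj x y == (i.+1 == j) || (j.+1 == i))) ->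
  iso G (seqjoin s).
Proof.
move=> emb cover cross.
pose J (i : 'I_(size s)) : finType := nth (complete 0) s i.
have [phi phiP] : exists phi : forall i : 'I_(size s), J i -> G, forall i,
   [/\ injective (phi i), forall y, (y \in cell i) = (y \in codom (phi i))
     & forall x y : nth (complete 0) s i, adj (phi i x) (phi i y) = adj x y].
  have /fin_all_exists : forall i : 'I_(size s), exists f : J i -> G,
    [/\ injective f, forall y, (y \in cell i) = (y \in codom f)
     & forall x y : nth (complete 0) s i, adj (f x) (f y) = adj x y].
    by move=> i; apply: emb.
  by [].
pose F (u : seqjoin s) : G := phi (tag u) (tagged u).
have Fcell u : F u \in cell (tag u).
  by have [_ -> _] := phiP (tag u); apply: codom_f.
have FE u v : adj (F u) (F v) = adj u v.
  case: u v => [i x] [j y]; change (adj (phi i x) (phi j y) = seqjoin_adj (Tagged J x) (Tagged J y)).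
  rewrite /seqjoin_adj /=; case: (eqVneq i j) y => [<- y|ij y].
    by rewrite tagged_asE; have [_ _ ->] := phiP i.
  have := cross i j (phi i x) (phi j y) (Fcell (Tagged J x)) (Fcell (Tagged J y)).
  by rewrite -val_eqE in ij; move=> /(_ ij)/andP[_ /eqP].
have Finj : injective F.
  move=> [i x] [j y] e; have := Fcell (Tagged J x); have := Fcell (Tagged J y).
  have [ij|ij] := eqVneq i j.
    case: j / ij y e => y e _ _; have [inj _ _] := phiP i.
    by rewrite (inj x y e).
  move=> cj ci; have := cross i j _ _ ci cj.
  by rewrite -val_eqE in ij; move=> /(_ ij)/andP[]; rewrite e eqxx.
have Fsurj x : exists u, F u = x.
  have [i si xi] := cover x.
  have [_ cod _] := phiP (Ordinal si).
  by move: xi; rewrite (cod x) => /codomP[y ->]; exists (Tagged J (y : J (Ordinal si))).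
have Fcard : #|G| <= #|seqjoin s|.
  rewrite -(card_codom Finj); apply: subset_leq_card; apply/subsetP => x _.
  by have [u <-] := Fsurj x; apply: codom_f.
have [F' FK F'K] := inj_card_bij Finj Fcard.
exists F'; first by exists F.
by move=> x y; rewrite -FE !F'K.
Qed.

(** * Degrees in sequential joins *)

Definition deg (T : sgraph) (x : T) := #|[set y | adj x y]|.

Lemma deg_sum (T : sgraph) (x : T) : deg x = \sum_(y : T) (adj x y : nat).
Proof. by rewrite /deg cardsE -sum1_card big_mkcond. Qed.

Lemma deg_complete n (x : complete n) : deg x + 1 = n.
Proof.
rewrite /deg (_ : [set y | adj x y] = [set~ x]) ?cardsC1 ?card_ord.
  by case: n x => [[]//|n] x; rewrite addn1.
by apply/setP => y; rewrite !inE eq_sym.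
Qed.

Lemma deg_compl (T : sgraph) (x : compl T) : deg x + deg (x : T) + 1 = #|T|.
Proof.
rewrite -cardsT -(@card_conbrs T [set: T] x) ?inE //; congr (_ + _ + _).
  by apply: eq_card => y; rewrite !inE.
by apply: eq_card => y; rewrite !inE.
Qed.

(** For even [x] the partner [x.+1] is below [n] because [n] is even. Lower bounds are what is
    wanted for matchings and cycles: they enter through their complements, whose degrees are to be
    bounded above. *)
Lemma deg_matching n (x : matching n) : ~~ odd n -> 0 < deg x.
Proof.
move=> evn; pose y := if odd x then x.-1 else x.+1.
have yn : y < n by rewrite /y; have := ltn_ord x; case: ifP; lia.
apply/card_gt0P; exists (Ordinal yn); rewrite inE.
change ((x != Ordinal yn) && (x./2 == y./2)).
rewrite -val_eqE /= /y; case: ifP => ox; lia.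
Qed.

Lemma deg_cycle n (x : cycle_graph n) : 3 <= n -> 1 < deg x.
Proof.
move=> n3; have xn := ltn_ord x.
have sx : ordS x != x.
  rewrite -val_eqE /=; have [e|lt] : x.+1 = n \/ x.+1 < n by lia.
    by rewrite e modnn; lia.
  by rewrite modn_small //; lia.
have px : ord_pred x != x.
  by apply: contraNneq sx => e; rewrite -{1}e ord_predK.
have sp : ordS x != ord_pred x.
  rewrite -val_eqE /=.
  have [x0|x0] := posnP x; first by rewrite x0 add0n !modn_small; lia.
  have -> : (x + n).-1 = x.-1 + n by lia.
  rewrite modnDr (@modn_small x.-1) ?[X in X < _]prednK //; last by lia.
  have [e|lt] : x.+1 = n \/ x.+1 < n by lia.
    by rewrite e modnn; lia.
  by rewrite modn_small //; lia.
have <- : #|[set ordS x; ord_pred x]| = 2 by rewrite cards2 sp.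
apply: subset_leq_card; apply/subsetP => y.
rewrite !inE => /orP[/eqP->|/eqP->]; change (is_true (cycle_adj x (ordS x))) ||
  change (is_true (cycle_adj x (ord_pred x))); rewrite /cycle_adj.
  by rewrite eq_sym sx eqxx.
by rewrite eq_sym px ord_predK eqxx orbT.
Qed.

Lemma deg_cycles s (x : cycles_graph s) : all (leq 3) s -> 1 < deg x.
Proof.
elim: s x => [[]//|n s IH] x /= /andP[n3 s3].
case: x => [x|x].
  apply: leq_trans (deg_cycle x n3) _.
  rewrite /deg -(card_imset _ (@inl_inj _ (cycles_graph s))); apply: subset_leq_card.
  by apply/subsetP => _ /imsetP[y xy ->]; rewrite !inE in xy *.
apply: leq_trans (IH x s3) _.
rewrite /deg -(card_imset _ (@inr_inj (cycle_graph n) _)); apply: subset_leq_card.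
by apply/subsetP => _ /imsetP[y xy ->]; rewrite !inE in xy *.
Qed.

Lemma card_cycles s : #|cycles_graph s| = sumn s.
Proof. by elim: s => [|n s IH] /=; rewrite ?card_ord // card_sum card_ord IH. Qed.

Lemma seqjoin_degree (s : seq sgraph) (u : seqjoin s) :
  #|[set v | adj u v]| = @deg (nth (complete 0) s (tag u)) (tagged u) +
    \sum_(j < size s | ((tag u).+1 == j) || (j.+1 == tag u)) #|nth (complete 0) s j|.
Proof.
rewrite -/(deg u) deg_sum; case: u => i x.
pose J (i : 'I_(size s)) : finType := nth (complete 0) s i.
transitivity (\sum_(j < size s) \sum_(y : J j) (seqjoin_adj (Tagged J x) (Tagged J y) : nat)).
  rewrite (@sig_big_dep _ _ _ _ _ xpredT (fun=> xpredT)
     (fun j y => (seqjoin_adj (Tagged J x) (Tagged J y) : nat))).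
  by apply: eq_big => [|[j y]].
rewrite (bigD1 i) //=; congr (_ + _).
  by rewrite deg_sum; apply: eq_bigr => y _; rewrite /seqjoin_adj /= eqxx tagged_asE.
rewrite [RHS]big_mkcond [LHS]big_mkcond; apply: eq_bigr => j _.
rewrite -val_eqE /=; case: (eqVneq (j : nat) i) => [ji|ji] /=.
  by rewrite ji gtn_eqF ?ltnn //= gtn_eqF.
under eq_bigr => y _.
  rewrite /seqjoin_adj /= -val_eqE /= [_ == nat_of_ord j]eq_sym (negPf ji); over.
by rewrite sum_nat_const /=; case: ifP; rewrite ?muln1 ?muln0.
Qed.

Lemma five_cells_degree (C0 C1 C3 C4 : sgraph) (n0 c e n4 : nat) :
  #|C0| = n0 -> #|C1| = c -> #|C3| = e -> #|C4| = n4 ->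
  (forall x : C0, deg x + c <= c + e) -> (forall x : C1, deg x + n0 + 1 <= c + e) ->
  (forall x : C3, deg x + n4 + 1 <= c + e) -> (forall x : C4, deg x + e <= c + e) ->
  forall u : seqjoin [:: C0; C1; complete 1; C3; C4], #|[set v | adj u v]| <= c + e.
Proof.
move=> card0 card1 card3 card4 d0 d1 d3 d4 u; rewrite seqjoin_degree.
case: u => [[[|[|[|[|[|i]]]]] iP] x] //=; rewrite big_mkcond !big_ord_recl big_ord0 /=;
  rewrite ?card0 ?card1 ?card3 ?card4 ?card_ord.
- by have := d0 x; lia.
- by have := d1 x; lia.
- by have := @deg_complete 1 x; lia.
- by have := d3 x; lia.
- by have := d4 x; lia.
Qed.

(** * Cuts attaining the bound *)

Definition cut (G : sgraph) (v : G) (A B : {set G}) : Prop :=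
  [/\ side A v, side B v, B = ~: (v |: A), 0 < #|nbrs_in v A| & 0 < #|nbrs_in v B|].

Lemma cut_sym (G : sgraph) (v : G) (A B : {set G}) : cut v A B -> cut v B A.
Proof.
case=> sA sB BE cA cB; split=> //; apply/setP => x; rewrite BE !inE negb_or negbK.
by case: eqVneq => [->|//]; apply/negbTE; have [] := sA.
Qed.

Lemma cut_degree (G : sgraph) d (v : G) (A B : {set G}) : regular d G -> cut v A B ->
  #|nbrs_in v A| + #|nbrs_in v B| = d.
Proof.
move=> dreg [sA sB BE _ _]; rewrite -(dreg v) -(cardsID A [set y | adj v y]); congr (_ + _); apply: eq_card => x.
  by rewrite !inE andbC.
rewrite BE !inE negb_or; case vx: (adj v x); rewrite ?andbF //= !andbT.
by case: eqP => // xv; rewrite xv adj_irr in vx.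
Qed.

Section CutExtremal.
Variables (R : realType) (G : sgraph) (d : nat) (v : G) (A B : {set G}).
Hypotheses (dreg : regular d G) (cutAB : cut v A B).
Local Notation c := #|nbrs_in v A|.
Local Notation e := #|nbrs_in v B|.
Local Open Scope ring_scope.

(** If [c * e < p], the gap polynomial of the cut is positive at [mu], so this cut has a strictly
    smaller gap, against the bound on [lambda2]. If [c * e = p], the equality case of [cut_lambda2]
    applies. *)
Lemma cut_extremal (kA kB p : nat) (mu : R) :
  (d + kA <= #|A|)%N -> (d + kB <= #|B|)%N -> (c * e <= p)%N -> 0 < mu -> mu < 1 ->
  gap_poly (d + kA)%:R (d + kB)%:R d%:R p%:R mu = 0 ->
  lambda2 R G <= d%:R - mu ->
  [/\ (c * e)%N = p, #|A| = (d + kA)%N, complete_side A v,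
      #|B| = (d + kB)%N & complete_side B v].
Proof.
have ce := cut_degree dreg cutAB; case: cutAB => sA sB BE c0 e0.
move=> cardA cardB cep mu0 mu1 gap le.
have nA : (d + kA - c + c)%N = (d + kA)%N by lia.
have nB : (d + kB - e + e)%N = (d + kB)%N by lia.
have cut m : 0 < m -> m < 1 -> gap_poly (d + kA)%:R (d + kB)%:R d%:R (c * e)%:R m = 0 ->
  d%:R - m <= lambda2 R G /\ (lambda2 R G <= d%:R - m ->
    [/\ #|A| = (d + kA)%N, complete_side A v, #|B| = (d + kB)%N & complete_side B v]).
  move=> m0 m1 gapm; rewrite -nA -nB.
  apply: (@cut_lambda2 R G d (d + kA - c) (d + kB - e)) => //; rewrite ?nA ?nB //.
  by rewrite -natrD ce -natrM.
move: cep; rewrite leq_eqVlt => /orP[/eqP cep|cep].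
  have [_ /(_ le)[]] := cut mu mu0 mu1 ltac:(by rewrite cep).
  by split.
have [|||||m [m0 mlt gapm]] := @gap_poly_root R (d + kA)%:R (d + kB)%:R d%:R (c * e)%:R mu.
- by rewrite ltr0n; lia.
- by rewrite ltr0n; lia.
- by rewrite ltr0n muln_gt0 c0 e0.
- exact: mu0.
- rewrite (gap_polyB _ _ _ p%:R) gap add0r mulr_gt0 ?subr_gt0 ?ltr_nat //.
  have : (2 : R) <= (d + kA)%:R + (d + kB)%:R by rewrite -natrD ler_nat; lia.
  by lra.
have [] := cut m m0 (lt_trans mlt mu1) gapm.
by move=> lem _; exfalso; move: (le_trans lem le); lra.
Qed.

Lemma gap_exists (kA kB p : nat) : (3 <= d)%N -> (0 < kA)%N -> (0 < kB)%N -> (0 < p)%N ->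
  (4 * p <= d ^ 2)%N ->
  exists mu : R, [/\ 0 < mu, mu < 1 & gap_poly (d + kA)%:R (d + kB)%:R d%:R p%:R mu = 0].
Proof.
move=> d3 kA0 kB0 p0 pd; apply: gap_poly_root => //; rewrite ?ltr0n ?addn_gt0 ?kA0 ?kB0 ?orbT //.
apply: gap_poly1_gt0.
- by rewrite (ler_nat _ 3).
- by rewrite -(natrD _ _ 1) ler_nat; lia.
- by rewrite -(natrD _ _ 1) ler_nat; lia.
- by rewrite -natrX -natrM ler_nat.
Qed.

Lemma iso_five (C0 C1 C3 C4 : sgraph) :
  complete_side A v -> complete_side B v ->
  embeds C0 (@adj G) (A :\: nbrs_in v A) -> embeds C1 (@adj G) (nbrs_in v A) ->
  embeds C3 (@adj G) (nbrs_in v B) -> embeds C4 (@adj G) (B :\: nbrs_in v B) ->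
  iso G (seqjoin [:: C0; C1; complete 1; C3; C4]).
Proof.
case: cutAB => sA sB BE _ _ cA cB E0 E1 E3 E4.
pose cells := [:: A :\: nbrs_in v A; nbrs_in v A; [set v]; nbrs_in v B; B :\: nbrs_in v B].
(* Numbering the cells turns their disjointness and covering into statements about [idx]. *)
pose idx (x : G) := (if x == v then 2 else if x \in A then (if adj v x then 1 else 0)
  else (if adj v x then 3 else 4))%N.
have vA : v \notin A := sA.1.
have xB x : (x \in B) = (x != v) && (x \notin A) by rewrite BE !inE negb_or.
have idxP i x : (x \in nth set0 cells i) = (idx x == i).
  rewrite /cells /idx.
  case: i => [|[|[|[|[|i]]]]] /=; rewrite ?nth_nil ?inE ?xB;
    (case: (eqVneq x v) => [xv|xv]; [rewrite ?xv ?adj_irr ?(negPf vA)|]);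
    case: (x \in A); case: (adj v x); rewrite ?inE //=.
apply: (@iso_seqjoin _ _ (nth set0 cells)).
- case=> [|[|[|[|[|i]]]]] //= _.
  apply: embeds_complete; first exact: cards1.
  by move=> x y /set1P-> /set1P->; rewrite eqxx.
- by move=> x; exists (idx x); rewrite ?idxP // /idx; do ![case: ifP].
move=> i j x y; rewrite !idxP => xi yj ij; apply/andP; split.
  by apply: contraNneq ij => xy; rewrite -(eqP xi) -(eqP yj) xy.
rewrite -(eqP xi) -(eqP yj) in ij *; move: ij; clear i j xi yj.
wlog lt : x y / (idx x < idx y)%N.
  move=> H ij; case: (ltngtP (idx x) (idx y)) => [lt|lt|e].
  - exact: H.
  - by rewrite adj_sym orbC; apply: H => //; rewrite eq_sym.
  - by rewrite e eqxx in ij.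
move=> _; move: lt; rewrite /idx.
have noAB a b : a \in A -> b \notin A -> b != v -> adj a b = false.
  move=> aA bA bv; apply/negbTE/negP => ab; have := sA.2 a b aA ab.
  by rewrite (negPf bA) (negPf bv).
have inA0 a : a \in A -> adj v a = false -> a \in A :\: nbrs_in v A.
  by move=> aA na; rewrite !inE aA na.
have inB0 a : a != v -> a \notin A -> adj v a = false -> a \in B :\: nbrs_in v B.
  by move=> av aA na; rewrite !inE xB av aA na.
have inA1 a : a \in A -> adj v a -> a \in nbrs_in v A by move=> aA na; rewrite !inE aA na.
have inB1 a : a != v -> a \notin A -> adj v a -> a \in nbrs_in v B.
  by move=> av aA na; rewrite !inE xB av aA na.
case: (eqVneq x v) => [->|xv].
  case: (eqVneq y v) => [->|yv] //; case: ifP => yA; case: ifP => vy //=.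
case: (eqVneq y v) => [->|yv].
  by case: ifP => xA; case: ifP => vx //= _; rewrite adj_sym vx.
case: ifPn => xA; case: ifP => vx; (case: ifPn => yA; case: ifP => vy) => //= _.
all: try by rewrite noAB.
- by rewrite adj_sym cA ?inA1 ?inA0.
- by rewrite cB ?inB1 ?inB0.
Qed.

End CutExtremal.

Section RegularCompleteSide.
Variables (G : sgraph) (d : nat) (S : {set G}) (u : G).
Hypotheses (dreg : regular d G) (sideS : side S u) (compS : complete_side S u).
Local Notation S1 := (nbrs_in u S).
Local Notation S0 := (S :\: S1).

Lemma card_outer k : #|S| = d + k -> #|S0| = d + k - #|S1|.
Proof.
move=> <-; rewrite cardsD; congr (_ - _); apply: eq_card => x; rewrite !inE.
by case: (x \in S).
Qed.

Lemma embeds_outer1 n : #|S| = d + 1 -> d + 1 - #|S1| = n ->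
  embeds (complete n) (@adj G) S0.
Proof.
move=> cardS nE; apply: embeds_complete; first by rewrite (card_outer cardS).
move=> x y xS0 yS0 xy; apply/negPn/negP => nxy.
have := conbrs_outer dreg sideS compS cardS xS0.
suff : 0 < #|conbrs S0 x| by lia.
by apply/card_gt0P; exists y; rewrite inE yS0 /compl_adj xy nxy.
Qed.

Lemma embeds_inner1 n : #|S| = d + 1 -> #|S1| = n ->
  embeds (compl (matching n)) (@adj G) S1.
Proof.
move=> cardS nE; apply: embeds_compl.
apply: embeds_matching => // [x y|x|x xS1]; [exact: compl_sym | exact: compl_irr |].
exact: (conbrs_inner dreg sideS compS cardS).
Qed.

Lemma embeds_outer2 n : #|S| = d + 2 -> d + 2 - #|S1| = n ->
  embeds (compl (matching n)) (@adj G) S0.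
Proof.
move=> cardS nE; apply: embeds_compl.
apply: embeds_matching; rewrite ?(card_outer cardS) //;
  [exact: compl_sym | exact: compl_irr |].
by move=> x xS0; have := conbrs_outer dreg sideS compS cardS xS0; rewrite /conbrs; lia.
Qed.

(** With excess 2 the complement of the inner cell is 2-regular; which union of cycles it is depends
    on [G]. *)
Lemma embeds_inner2 n : #|S| = d + 2 -> #|S1| = n ->
  exists2 C, is_cycle_union n C & embeds (compl C) (@adj G) S1.
Proof.
move=> cardS nE; have [||x xS1|s [s3 sumE emb]] := @embeds_cycles G (@compl_adj G) _ _ S1.
- exact: compl_sym.
- exact: compl_irr.
- exact: (conbrs_inner dreg sideS compS cardS).
by exists (cycles_graph s); [exists s; split; rewrite // sumE | apply: embeds_compl].
Qed.

End RegularCompleteSide.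

(** * Cubic graphs *)

Section Cubic.
Variable R : realType.
Local Open Scope ring_scope.

Let H := seqjoin [:: complete 2; compl (matching 2); complete 1;
                     complete 1; compl (matching 2); complete 2].

(* The root in (0, 1/4) is the gap of the weighted path with masses 2, 2, 1, 1, 2, 2,
   attained by an antisymmetric eigenvector. *)
Definition cubic_poly (mu : R) : R := mu ^+ 3 - 9 * mu ^+ 2 + 20 * mu - 4.

(** The polynomial is [-4] at 0 and positive at [1 / 4]; a root below [1 / 4] keeps the central
    value [g] of the eigenvector positive. *)
Lemma cubic_gap_exists : exists mu : R, [/\ 0 < mu, mu < 1 / 4 & cubic_poly mu = 0].
Proof.
pose P : {poly R} := 'X ^+ 3 - 9%:P * 'X ^+ 2 + 20%:P * 'X - 4%:P.
have PE x : P.[x] = cubic_poly x by rewrite /P /cubic_poly !hornerE.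
have [||mu mu01 /eqP] := @poly_ivtoo _ P 0 (1 / 4).
- by lra.
- by rewrite !PE /cubic_poly; lra.
by rewrite PE => mu0; exists mu; move: mu01; rewrite in_itv => /andP[].
Qed.

Lemma lambda2_cubic_le (mu : R) : 0 < mu -> mu < 1 / 4 -> cubic_poly mu = 0 ->
  lambda2 R H <= 3%:R - mu.
Proof.
rewrite /cubic_poly => mu0 mu4 gap.
(* Starting from the value 1, the equations of the first two cells give [al1] and [g]; the equation
   at the centre, with [- g] across the bridge, is then equivalent to [cubic_poly mu = 0]. *)
pose al1 : R := 1 - mu / 2; pose g : R := 1 - 5 * mu / 2 + mu ^+ 2 / 2.
have mu2 : 0 < mu ^+ 2 by rewrite exprn_gt0.
have mu2le : mu ^+ 2 <= mu / 4 by rewrite expr2; nra.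
pose x := nth 0 [:: 1; al1; g; - g; - al1; - 1].
have cardM : #|compl (matching 2)| = 2%N by rewrite card_ord.
have degM (y : compl (matching 2)) : deg y = 0%N.
  by have := deg_compl y; rewrite card_ord; have := @deg_matching 2 y isT; lia.
apply: (@lambda2_seqjoin_le _ _ 3 x) => //.
- by case=> [|[|[|[|[|[|i]]]]]] //= _; rewrite ?cardM ?card_ord.
- move=> u; rewrite seqjoin_degree.
  by case: u => [[[|[|[|[|[|[|i]]]]]] iP] y] //=; rewrite big_mkcond !big_ord_recl big_ord0 /=;
    rewrite ?cardM ?card_ord ?degM //; have := deg_complete y; lia.
- by rewrite mu0; lra.
- by case=> [|[|[|[|[|[|i]]]]]] //= _; rewrite /x /= /al1 /g; lra.
- by case=> [|[|[|[|[|[|i]]]]]] //= _; rewrite !big_ord_recr big_ord0 /= add0r /x /= ?cardM ?card_ord /al1 /g; lra.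
- by rewrite !big_ord_recr big_ord0 /= add0r /x /= ?cardM ?card_ord /al1 /g; lra.
Qed.

(** * Cubic graphs with a bridge from [v] to [w] *)

Section Cut.
Variables (G : sgraph) (v w : G) (A A' : {set G}).
Hypotheses (reg3 : regular 3 G) (cutAB : cut v A (w |: A')).
Hypotheses (cA : #|nbrs_in v A| = 2%N) (nw : nbrs_in v (w |: A') = [set w]).
Hypothesis wA' : w \notin A'.

Let vw : adj v w.
Proof. by have : w \in nbrs_in v (w |: A') by [rewrite nw set11]; rewrite inE => /andP[]. Qed.

Let BE : w |: A' = ~: (v |: A).
Proof. by case: cutAB. Qed.

Let sA : side A v. Proof. by case: cutAB. Qed.

Let wv : w != v. Proof. by apply: contraTneq vw => ->; rewrite adj_irr. Qed.

Let memA' x : (x \in A') = [&& x != w, x != v & x \notin A].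
Proof.
have /setP/(_ x) := BE; rewrite !inE negb_or => <-.
by case: (eqVneq x w) => [->|] //; rewrite (negPf wA').
Qed.

Let nvA' x : x \in A' -> adj v x = false.
Proof.
move=> xA'; apply/negbTE/negP => vx.
have : x \in nbrs_in v (w |: A') by rewrite !inE xA' orbT.
by rewrite nw inE => /eqP xw; move: wA'; rewrite -xw xA'.
Qed.

Let sA' : side A' w.
Proof.
split=> // x y xA' xy.
have xB : x \in w |: A' by rewrite inE xA' orbT.
have [_ sB _ _ _] := cutAB; have /orP[|/eqP yv] := sB.2 x y xB xy.
  by rewrite !inE orbC.
by rewrite yv adj_sym nvA' in xy.
Qed.

Let cA' : #|nbrs_in w A'| = 2%N.
Proof.
have := reg3 w; rewrite (cardsD1 v) inE adj_sym vw => -[<-].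
apply: eq_card => x; rewrite !inE memA'; case wx: (adj w x); rewrite ?andbF //= !andbT.
case: (eqVneq x v) => [_|xv] /=; first by rewrite andbF.
have -> : x != w by apply: contraTneq wx => ->; rewrite adj_irr.
apply/negP => xA; have := sA.2 x w xA; rewrite adj_sym wx => /(_ isT).
rewrite (negPf wv) orbF => wA; have : w \in w |: A' by rewrite !inE eqxx.
by rewrite BE !inE wA orbT.
Qed.

Let wA : w \notin A.
Proof.
have : w \in w |: A' by rewrite !inE eqxx.
by rewrite BE !inE negb_or => /andP[].
Qed.

(** Both ends of the bridge satisfy the eigenvector equation exactly, so only [A] and [A']
    contribute to the sums. Since [g > 0], the positive part is [A] with [v] and the negative part
    [A'] with [w]. *)
Lemma cubic_cut (mu : R) : 0 < mu -> mu < 1 / 4 -> cubic_poly mu = 0 ->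
  lambda2 R G <= 3%:R - mu -> 
  [/\ #|A| = (3 + 1)%N, complete_side A v, #|A'| = (3 + 1)%N & complete_side A' w].
Proof.
rewrite /cubic_poly => mu0 mu4 gap le.
have mu2 : 0 < mu ^+ 2 by rewrite exprn_gt0.
pose al1 : R := 1 - mu / 2; pose g : R := 1 - 5 * mu / 2 + mu ^+ 2 / 2.
have al1p : 0 < al1 by rewrite /al1; lra.
have gp : 0 < g by rewrite /g; lra.
have vA : v \notin A := sA.1.
pose f x : R := if x == v then g else if x == w then - g else
  if x \in A then (if adj v x then al1 else 1) else (if adj w x then - al1 else - 1).
have neqA x : x \in A -> (x == v = false) * (x == w = false).
  by move=> xA; split; apply/eqP => e; [move: vA|move: wA]; rewrite -e xA.
have neqA' x : x \in A' -> (x == v = false) * (x == w = false) * (x \in A = false).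
  by rewrite memA' => /and3P[/negPf -> /negPf -> /negPf ->].
have fA0 : {in A :\: nbrs_in v A, forall x, f x = 1}.
  by move=> x; rewrite !inE => /andP[nx xA]; rewrite /f !neqA // xA; move: nx; rewrite xA /= => /negPf ->.
have fA1 : {in nbrs_in v A, forall x, f x = al1}.
  by move=> x; rewrite !inE => /andP[xA nx]; rewrite /f !neqA // xA nx.
have fB0 : {in A' :\: nbrs_in w A', forall x, f x = - 1}.
  by move=> x; rewrite !inE => /andP[nx xA]; rewrite /f !neqA' //; move: nx; rewrite xA /= => /negPf ->.
have fB1 : {in nbrs_in w A', forall x, f x = - al1}.
  by move=> x; rewrite !inE => /andP[xA nx]; rewrite /f !neqA' // nx.
have fv : f v = g by rewrite /f eqxx.
have fw : f w = - g by rewrite /f (negPf wv) eqxx.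
have lapv : lap f v = mu * f v.
  rewrite /lap (bigD1 w) //= fv fw.
  rewrite (eq_bigl (mem (nbrs_in v A))) => [|x]; last first.
    rewrite !inE; case vx: (adj v x); rewrite ?andbF //= andbT.
    apply/idP/idP => [xw|xA]; last by rewrite !neqA.
    apply/negPn/negP => xA; have : x \in A' .
      by rewrite memA' xw xA andbT; apply: contraTneq vx => ->; rewrite adj_irr.
    by move/nvA'; rewrite vx.
  rewrite (eq_bigr (fun=> g - al1)) => [|x /fA1 ->] //.
  by rewrite sumr_const cA mulr2n /g /al1; lra.
have lapw : lap f w = mu * f w.
  rewrite /lap (bigD1 v) /=; last by rewrite adj_sym.
  rewrite fv fw (eq_bigl (mem (nbrs_in w A'))) => [|x]; last first.
    rewrite !inE; case wx: (adj w x); rewrite ?andbF //= andbT.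
    apply/idP/idP => [xv|xA]; last by rewrite !neqA'.
    rewrite memA' xv /=.
    have -> : x != w by apply: contraTneq wx => ->; rewrite adj_irr.
    apply/negP => xA; have := sA.2 x w xA; rewrite adj_sym wx => /(_ isT).
    by rewrite (negPf wv) (negPf wA).
  rewrite (eq_bigr (fun=> - g - - al1)) => [|x /fB1 ->] //.
  by rewrite sumr_const cA' mulr2n /g /al1; lra.
have cardA : (2 + #|nbrs_in v A| <= #|A|)%N.
  by have := side_card reg3 sA; rewrite cA; apply.
have cardA' : (2 + #|nbrs_in w A'| <= #|A'|)%N.
  by have := side_card reg3 sA'; rewrite cA'; apply.
have [sumA sumA0] : \sum_(x in A) f x * (lap f x - mu * f x) <= 0 /\
  (\sum_(x in A) f x * (lap f x - mu * f x) = 0 ->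
    #|A| = (2 + #|nbrs_in v A|)%N /\ complete_side A v).
  apply: (side_sum sA fA0 fA1 fv) => //; rewrite ?cA ?oner_neq0 //.
  - by rewrite /al1 /g; lra.
  - by rewrite /al1; lra.
  - by lra.
have [sumB sumB0] : \sum_(x in A') f x * (lap f x - mu * f x) <= 0 /\
  (\sum_(x in A') f x * (lap f x - mu * f x) = 0 ->
    #|A'| = (2 + #|nbrs_in w A'|)%N /\ complete_side A' w).
  apply: (side_sum sA' fB0 fB1 fw) => //; rewrite ?cA' ?oppr_eq0 ?oner_neq0 //.
  - by rewrite /al1 /g; lra.
  - by rewrite /al1; lra.
  - by lra.
have fApos x : x \in A -> 0 < f x.
  by move=> xA; rewrite /f !neqA // xA; case: ifP.
have fBneg x : x \in A' -> f x < 0.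
  by move=> xA; rewrite /f !neqA' //; case: ifP; rewrite oppr_lt0.
have G1 : (1 < #|G|)%N by apply: leq_trans (max_card (mem A)); apply: leq_trans cardA; rewrite cA.
have vt : f v * (lap f v - mu * f v) = 0 by rewrite lapv subrr mulr0.
have wt : f w * (lap f w - mu * f w) = 0 by rewrite lapw subrr mulr0.
have CX : ~: (v |: A) = w |: A' by [].
have [||||||_ /(_ le)] := @two_part_lambda2 R G 3 f (v |: A) mu reg3 G1.
- by move=> x; rewrite !inE => /orP[/eqP->|/fApos/ltW //]; rewrite fv ltW.
- by move=> x; rewrite CX !inE => /orP[/eqP->|/fBneg/ltW //]; rewrite fw oppr_le0 ltW.
- by rewrite big_setU1 //= fv ltr_pwDl // sumr_ge0 // => x /fApos/ltW.
- rewrite CX big_setU1 //= fw; have : \sum_(x in A') f x <= 0.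
    by apply: sumr_le0 => x /fBneg/ltW.
  by lra.
- by rewrite big_setU1 //= vt add0r.
- by rewrite CX big_setU1 //= wt add0r.
rewrite big_setU1 //= vt add0r CX big_setU1 //= wt add0r.
by move=> [/sumA0[-> ?] /sumB0[-> ?]]; rewrite cA cA'.
Qed.

Lemma cubic_iso : #|A| = (3 + 1)%N -> complete_side A v ->
  #|A'| = (3 + 1)%N -> complete_side A' w -> iso G H.
Proof.
move=> cardA compA cardA' compA'.
have vA : v \notin A := sA.1.
pose cells := [:: A :\: nbrs_in v A; nbrs_in v A; [set v]; [set w];
                  nbrs_in w A'; A' :\: nbrs_in w A'].
pose idx (x : G) := (if x == v then 2 else if x == w then 3 else
  if x \in A then (if adj v x then 1 else 0) else (if adj w x then 4 else 5))%N.
have idxP i x : (x \in nth set0 cells i) = (idx x == i).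
  rewrite /cells /idx.
  case: i => [|[|[|[|[|[|i]]]]]] /=; rewrite ?nth_nil ?inE ?memA';
    (case: (eqVneq x v) => [xv|xv]; [rewrite ?xv ?(eq_sym v w) ?(negPf wv) ?adj_irr ?(negPf vA)|
      case: (eqVneq x w) => [xw|xw]; [rewrite ?xw ?(negPf wA)|]]);
    case: (x \in A); case: (adj v x); case: (adj w x); rewrite ?inE ?andbF //=.
apply: (@iso_seqjoin _ _ (nth set0 cells)).
- case=> [|[|[|[|[|[|i]]]]]] //= _.
  + by apply: (embeds_outer1 reg3 sA compA cardA); rewrite cA.
  + exact: (embeds_inner1 reg3 sA compA cardA).
  + apply: embeds_complete; first exact: cards1.
    by move=> x y /set1P-> /set1P->; rewrite eqxx.
  + apply: embeds_complete; first exact: cards1.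
    by move=> x y /set1P-> /set1P->; rewrite eqxx.
  + exact: (embeds_inner1 reg3 sA' compA' cardA').
  + by apply: (embeds_outer1 reg3 sA' compA' cardA'); rewrite cA'.
- by move=> x; exists (idx x); rewrite ?idxP // /idx; do ![case: ifP].
move=> i j x y; rewrite !idxP => xi yj ij; apply/andP; split.
  by apply: contraNneq ij => xy; rewrite -(eqP xi) -(eqP yj) xy.
rewrite -(eqP xi) -(eqP yj) in ij *; move: ij; clear i j xi yj.
wlog lt : x y / (idx x < idx y)%N.
  move=> IH ij; case: (ltngtP (idx x) (idx y)) => [lt|lt|e].
  - exact: IH.
  - by rewrite adj_sym orbC; apply: IH => //; rewrite eq_sym.
  - by rewrite e eqxx in ij.
move=> _; move: lt; rewrite /idx.
have noAB a b : a \in A -> b \notin A -> b != v -> adj a b = false.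
  move=> aA bA bv; apply/negbTE/negP => ab; have := sA.2 a b aA ab.
  by rewrite (negPf bA) (negPf bv).
have inA0 a : a \in A -> adj v a = false -> a \in A :\: nbrs_in v A.
  by move=> aA na; rewrite !inE aA na.
have inA1 a : a \in A -> adj v a -> a \in nbrs_in v A by move=> aA na; rewrite !inE aA na.
have inB a : a != v -> a != w -> a \notin A -> a \in A'.
  by move=> av aw aA; rewrite memA' av aw aA.
have inB0 a : a != v -> a != w -> a \notin A -> adj w a = false -> a \in A' :\: nbrs_in w A'.
  by move=> av aw aA na; rewrite !inE na inB ?andbF.
have inB1 a : a != v -> a != w -> a \notin A -> adj w a -> a \in nbrs_in w A'.
  by move=> av aw aA na; rewrite inE na inB.
case: (eqVneq x v) => [->|xv].
  case: (eqVneq y v) => [->|yv] //; case: (eqVneq y w) => [->|yw]; first by rewrite vw.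
  case: ifPn => yA; case: ifP => wy //= _; rewrite ?nvA' ?inB //.
case: (eqVneq y v) => [->|yv].
  case: (eqVneq x w) => // xw; case: ifPn => xA; case: ifP => vx //= _; rewrite adj_sym ?vx //.
case: (eqVneq x w) => [->|xw].
  case: (eqVneq y w) => [->|yw] //; case: ifPn => yA; case: ifP => wy //= _; rewrite ?wy //.
case: (eqVneq y w) => [->|yw].
  by case: ifPn => xA; case: ifP => vx //= _; rewrite noAB.
case: ifPn => xA; case: ifP => vx; (case: ifPn => yA; case: ifP => vy) => //= _.
all: try by rewrite noAB.
- by rewrite adj_sym compA ?inA1 ?inA0.
- by rewrite compA' ?inB1 ?inB0.
Qed.

End Cut.

End Cubic.

(** * Extremal cuts *)

(** A vertex and its neighbours are the four vertices that [kappa_lt2_cut_vertex] asks for. *)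
Lemma regular_cut (d : nat) (G : sgraph) : 3 <= d -> connected G -> regular d G ->
  kappa G < 2 -> exists (v : G) (A B : {set G}), cut v A B.
Proof.
move=> d3 conn dreg k2.
have [v [A [sA sB cA cB]]] : exists (v : G) (A : {set G}), let B := ~: (v |: A) in
    [/\ side A v, side B v, 0 < #|nbrs_in v A| & 0 < #|nbrs_in v B|].
  apply: kappa_lt2_cut_vertex => //.
  have [/card_gt0P[x _] _] := andP conn.
  apply: leq_ltn_trans d3 _; rewrite -(dreg x) -cardsT; apply: proper_card.
  by apply/properP; split; [exact: subsetT | exists x; rewrite ?inE ?adj_irr].
by exists v, A, (~: (v |: A)).
Qed.

Section Cuts.
Variables (d : nat) (G : sgraph) (v : G) (A B : {set G}).
Hypotheses (dreg : regular d G) (cutAB : cut v A B).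

Lemma cut_card : d + 1 <= #|A|.
Proof.
have ce := cut_degree dreg cutAB; case: cutAB => sA _ _ c0 e0.
by apply: (side_card dreg sA); lia.
Qed.

Lemma cut_parity : odd (d * #|A|) = odd #|nbrs_in v A|.
Proof. by case: cutAB => sA _ _ _ _; apply: side_parity. Qed.

(** With exactly [d + 1] vertices, [d * #|A|] would be even, against [cut_parity]. *)
Lemma cut_card_odd : odd d -> odd #|nbrs_in v A| -> d + 2 <= #|A|.
Proof.
move=> od; rewrite -cut_parity oddM od /= => oA; have := cut_card.
by rewrite leq_eqVlt => /orP[/eqP e|]; [move: oA; rewrite -e addn1 /= od | rewrite addn1 addn2].
Qed.

End Cuts.

(** On a side of size [d + kA], a vertex of the outer cell misses at least [kA] vertices of its
    cell, itself included, and one of the inner cell at least [kA + 1]; this keeps all degrees at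
    most [d]. *)
Lemma lambda2_five_le (R : realType) (C0 C1 C3 C4 : sgraph) (d c e kA kB : nat) (mu : R) :
  c + e = d -> 0 < c -> 0 < e -> #|C0| = d + kA - c -> #|C1| = c ->
  #|C3| = e -> #|C4| = d + kB - e ->
  (forall x : C0, deg x + kA <= #|C0|) -> (forall x : C1, deg x + kA + 1 <= #|C1|) ->
  (forall x : C3, deg x + kB + 1 <= #|C3|) -> (forall x : C4, deg x + kB <= #|C4|) ->
  (0 < mu)%R -> (mu < 1)%R ->
  gap_poly (d + kA)%:R (d + kB)%:R d%:R (c * e)%:R mu = 0%R ->
  (lambda2 R (seqjoin [:: C0; C1; complete 1; C3; C4]) <= d%:R - mu)%R.
Proof.
move=> ced c0 e0 card0 card1 card3 card4 d0 d1 d3' d4 mu0 mu1 gap.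
rewrite -ced; apply: (lambda2_five_cells card0 card1 _ card3 card4) => //; try lia.
- exact: card_ord.
- apply: (five_cells_degree card0 card1 card3 card4) => x.
  + by have := d0 x; lia.
  + by have := d1 x; lia.
  + by have := d3' x; lia.
  + by have := d4 x; lia.
- by rewrite !subnK; [rewrite -natrD ced -natrM|lia|lia].
Qed.

Lemma deg_complete_le n (x : complete n) : deg x + 1 <= #|complete n|.
Proof. by rewrite card_ord deg_complete. Qed.

Lemma deg_compl_matching_le n (x : compl (matching n)) : ~~ odd n ->
  deg x + 2 <= #|compl (matching n)|.
Proof. by move=> /(@deg_matching n x); have := deg_compl x; rewrite !card_ord; lia. Qed.

Lemma deg_compl_cycles_le n C (x : compl C) : is_cycle_union n C -> deg x + 3 <= #|compl C|.
Proof.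
case=> s [s3 _ CE]; subst C; have := @deg_cycles s x s3.
by have := deg_compl x; rewrite -/(#|compl (cycles_graph s)|); lia.
Qed.

Lemma card_cycle_union n C : is_cycle_union n C -> #|C| = n.
Proof. by case=> s [_ <- ->]; apply: card_cycles. Qed.

Lemma mul_eq_of_sum (c e c' e' : nat) : c + e = c' + e' -> c * e = c' * e' ->
  c = c' \/ c = e'.
Proof. nia. Qed.

Lemma mul_le_mid (c e m : nat) : c + e = m + (m + 1) -> c * e <= m * (m + 1).
Proof.
wlog ce : c e / c <= e => [H cem|cem].
  by case: (leqP c e) => [ce|/ltnW ec]; [apply: H | rewrite mulnC; apply: H => //; rewrite addnC].
have [k mE] : exists k, m = c + k by exists (m - c); lia.
have -> : e = c + 2 * k + 1 by lia.
by rewrite mE; nia.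
Qed.

(** * Comparison of an arbitrary cut with the extremal one, by degree *)

Lemma cubic_case (R : realType) (G H : sgraph) : connected G -> regular 3 G ->
  is_Gdc 3 1 H -> (lambda2 R G <= lambda2 R H)%R ->
  ~ iso G (seqjoin [:: complete 2; compl (matching 2); complete 1;
                       complete 1; compl (matching 2); complete 2]) ->
  2 <= kappa G.
Proof.
move=> conn reg3 isH le niso; rewrite leqNgt; apply/negP => k2; apply: niso.
have [v [A0 [B0 cut0]]] := @regular_cut 3 G isT conn reg3 k2.
(* The three neighbours of [v] split as 2 and 1, so one edge at [v] is a bridge; [B] is the side
   beyond it. *)
have [A [B [cutAB cA cB]]] : exists A B, [/\ cut v A B, #|nbrs_in v A| = 2 & #|nbrs_in v B| = 1].
  have ce := cut_degree reg3 cut0; have [_ _ _ c0 e0] := cut0.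
  have [c1|c2] : #|nbrs_in v A0| = 2 \/ #|nbrs_in v A0| = 1 by lia.
    by exists A0, B0; split=> //; lia.
  by exists B0, A0; split; [exact: cut_sym| lia | lia].
have /eqP/cards1P[w nw] := cB.
have wB : w \in B.
  by have : w \in nbrs_in v B by [rewrite nw set11]; rewrite inE => /andP[].
have BE : B = w |: (B :\ w) by rewrite setD1K.
have wA' : w \notin B :\ w by rewrite !inE eqxx.
rewrite BE in cutAB nw.
have [mu [mu0 mu4 gap]] := cubic_gap_exists R.
have leH : (lambda2 R H <= 3%:R - mu)%R.
  by case: isH => // *; apply: lambda2_cubic_le.
have [cardA compA cardA' compA'] := cubic_cut reg3 cutAB cA nw wA' mu0 mu4 gap (le_trans le leH).
exact: (cubic_iso reg3 cutAB cA nw wA').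
Qed.

Lemma even_case (R : realType) (d : nat) (G H : sgraph) : connected G -> regular d G ->
  4 <= d -> ~~ odd d -> is_Gdc d (2 * (d %/ 4)) H -> (lambda2 R G <= lambda2 R H)%R ->
  ~ iso G (seqjoin [:: complete (2 * ((d + 2) %/ 4) + 1);
                       compl (matching (2 * (d %/ 4)));
                       complete 1;
                       compl (matching (2 * ((d + 2) %/ 4)));
                       complete (2 * (d %/ 4) + 1)]) ->
  2 <= kappa G.
Proof.
move=> conn dreg d4 evd isH le niso; rewrite leqNgt; apply/negP => k2; apply: niso.
have d3 : 3 <= d by lia.
have [v [A0 [B0 cut0]]] := regular_cut d3 conn dreg k2.
have [A [B [cutAB leAB]]] : exists A B, cut v A B /\ #|nbrs_in v A| <= #|nbrs_in v B|.
  case: (leqP #|nbrs_in v A0| #|nbrs_in v B0|) => [leAB|/ltnW leBA].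
    by exists A0, B0.
  by exists B0, A0; split=> //; apply: cut_sym.
have ce := cut_degree dreg cutAB; have cutBA := cut_sym cutAB.
have [sA sB BE c0 e0] := cutAB.
(* Parity makes [cs] optimal: it is the largest even number not exceeding [d / 2]. *)
have ec : ~~ odd #|nbrs_in v A| by rewrite -(cut_parity dreg cutAB) oddM (negPf evd).
set c := #|nbrs_in v A| in leAB ce c0 ec *; set e := #|nbrs_in v B| in leAB ce e0 *.
set cs := 2 * (d %/ 4) in isH *; set es := 2 * ((d + 2) %/ 4).
have cses : cs + es = d by rewrite /cs /es; lia.
have cs2 : cs <= es <= cs + 2 by rewrite /cs /es; lia.
have cs0 : 0 < cs by rewrite /cs; lia.
have ecs : ~~ odd cs by rewrite /cs; lia.
have ees : ~~ odd es by rewrite /es; lia.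
clearbody cs es.
have cle : c <= cs by lia.
have pd : 4 * (cs * es) <= d ^ 2 by rewrite -cses; nia.
have [mu [mu0 mu1 gap]] := @gap_exists R d 1 1 (cs * es) d3 isT isT ltac:(by rewrite muln_gt0; lia) pd.
have leH : (lambda2 R H <= d%:R - mu)%R.
  case: isH => [od|C od|C od|_ _ _ _]; try by rewrite od in evd.
  have dcs : d - cs = es by lia.
  apply: (@lambda2_five_le _ _ _ _ _ d cs es 1 1) => //.
  - by lia.
  - by rewrite card_ord; lia.
  - by rewrite card_ord.
  - by rewrite card_ord.
  - by rewrite card_ord; lia.
  - by move=> x; apply: deg_complete_le.
  - by move=> x; rewrite -addnA; apply: deg_compl_matching_le.
  - by move=> x; rewrite -addnA; apply: deg_compl_matching_le; rewrite dcs.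
  - by move=> x; apply: deg_complete_le.
have cep : c * e <= cs * es by nia.
have [ceE cardA compA cardB compB] :=
  cut_extremal dreg cutAB (cut_card dreg cutAB) (cut_card dreg cutBA) cep mu0 mu1 gap (le_trans le leH).
have cE : c = cs by have [] := @mul_eq_of_sum c e cs es _ ceE; lia.
have eE : e = es by lia.
apply: (iso_five cutAB compA compB).
- by apply: (embeds_outer1 dreg sA compA cardA); rewrite -/c; lia.
- exact: (embeds_inner1 dreg sA compA cardA).
- exact: (embeds_inner1 dreg sB compB cardB).
- by apply: (embeds_outer1 dreg sB compB cardB); rewrite -/e; lia.
Qed.

(** As [d] is odd, exactly one side contains an odd number of neighbours of [v]; that side is named
    [A]. *)
Lemma odd_cut (d : nat) (G : sgraph) (v : G) (A0 B0 : {set G}) : odd d ->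
  regular d G -> cut v A0 B0 -> exists A B, [/\ cut v A B, odd #|nbrs_in v A|,
    d + 2 <= #|A| & d + 1 <= #|B|].
Proof.
move=> od dreg cut0; have ce := cut_degree dreg cut0; have cut0' := cut_sym cut0.
have [oA|eA] := boolP (odd #|nbrs_in v A0|).
  exists A0, B0; split=> //; first exact: (cut_card_odd dreg cut0).
  exact: (cut_card dreg cut0').
have oB : odd #|nbrs_in v B0| by move: od; rewrite -ce oddD (negPf eA).
exists B0, A0; split=> //; first exact: (cut_card_odd dreg cut0').
exact: (cut_card dreg cut0).
Qed.

Lemma odd_odd_case (R : realType) (d : nat) (G H : sgraph) : connected G -> regular d G ->
  5 <= d -> odd d -> odd ((d - 1) %/ 2) -> is_Gdc d ((d - 1) %/ 2) H ->
  (lambda2 R G <= lambda2 R H)%R ->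
  (forall C : sgraph, is_cycle_union ((d - 1) %/ 2) C ->
    ~ iso G (seqjoin [:: compl (matching ((d + 5) %/ 2));
                         compl C;
                         complete 1;
                         compl (matching ((d + 1) %/ 2));
                         complete ((d + 1) %/ 2)])) ->
  2 <= kappa G.
Proof.
move=> conn dreg d5 od ocs isH le niso; rewrite leqNgt; apply/negP => k2.
have d3 : 3 <= d by lia.
have [v [A0 [B0 cut0]]] := regular_cut d3 conn dreg k2.
have [A [B [cutAB oc cardA cardB]]] := odd_cut od dreg cut0.
have ce := cut_degree dreg cutAB; have [sA sB BE c0 e0] := cutAB.
set cs := (d - 1) %/ 2 in ocs isH niso; set es := (d + 1) %/ 2 in niso.
have cses : cs + es = d by rewrite /cs /es; lia.
have esE : es = cs + 1 by rewrite /cs /es; lia.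
have d52 : (d + 5) %/ 2 = d + 2 - cs by rewrite /cs; lia.
rewrite d52 in niso.
have cs3 : 3 <= cs by move: ocs; lia.
clearbody cs es.
have pd : 4 * (cs * es) <= d ^ 2 by rewrite -cses esE; nia.
have [mu [mu0 mu1 gap]] := @gap_exists R d 2 1 (cs * es) d3 isT isT ltac:(by rewrite muln_gt0; lia) pd.
have leH : (lambda2 R H <= d%:R - mu)%R.
  (* The other constructors are excluded by the range or by a parity. *)
  case: isH => [_ _ /orP[/eqP|/eqP]|C _ _ _ _ CU|C _ _ ecs|ed]; try lia.
  have dcs : d - cs = es by lia.
  apply: (@lambda2_five_le _ _ _ _ _ d cs es 2 1) => //.
  - by lia.
  - by lia.
  - by rewrite card_ord; lia.
  - exact: card_cycle_union CU.
  - by rewrite card_ord.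
  - by rewrite card_ord; lia.
  - by move=> x; apply: deg_compl_matching_le; lia.
  - by move=> x; rewrite -addnA; apply: deg_compl_cycles_le CU.
  - by move=> x; rewrite -addnA; apply: deg_compl_matching_le; lia.
  - by move=> x; apply: deg_complete_le.
set c := #|nbrs_in v A| in oc ce c0; set e := #|nbrs_in v B| in ce e0.
have cep : c * e <= cs * es by rewrite esE mul_le_mid //; lia.
have [ceE cardA' compA cardB' compB] :=
  cut_extremal dreg cutAB cardA cardB cep mu0 mu1 gap (le_trans le leH).
(* The alternative [c = es] is impossible, [c] being odd and [es = cs + 1] even. *)
have cE : c = cs by have [] := @mul_eq_of_sum c e cs es _ ceE; lia.
have eE : e = es by lia.
have [C CU embC] := embeds_inner2 dreg sA compA cardA' cE.
apply: (niso C CU); apply: (iso_five cutAB compA compB) => //.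
- by apply: (embeds_outer2 dreg sA compA cardA'); rewrite -/c; lia.
- exact: (embeds_inner1 dreg sB compB cardB').
- by apply: (embeds_outer1 dreg sB compB cardB'); rewrite -/e; lia.
Qed.

Lemma odd_even_case (R : realType) (d : nat) (G H : sgraph) : connected G -> regular d G ->
  5 <= d -> odd d -> ~~ odd ((d - 1) %/ 2) -> is_Gdc d ((d - 1) %/ 2) H ->
  (lambda2 R G <= lambda2 R H)%R ->
  (forall C : sgraph, is_cycle_union ((d + 1) %/ 2) C ->
    ~ iso G (seqjoin [:: complete ((d + 3) %/ 2);
                         compl (matching ((d - 1) %/ 2));
                         complete 1;
                         compl C;
                         compl (matching ((d + 3) %/ 2))])) ->
  2 <= kappa G.
Proof.
move=> conn dreg d5 od ecs isH le niso; rewrite leqNgt; apply/negP => k2.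
have d3 : 3 <= d by lia.
have [v [A0 [B0 cut0]]] := regular_cut d3 conn dreg k2.
(* The odd side is called [B] here, because [es = cs + 1] is now the odd part of [d]. *)
have [B [A [cutBA oe cardB cardA]]] := odd_cut od dreg cut0.
have cutAB := cut_sym cutBA.
have ce := cut_degree dreg cutAB; have [sA sB BE c0 e0] := cutAB.
set cs := (d - 1) %/ 2 in ecs isH niso; set es := (d + 1) %/ 2 in niso.
have cses : cs + es = d by rewrite /cs /es; lia.
have esE : es = cs + 1 by rewrite /cs /es; lia.
have d32 : (d + 3) %/ 2 = cs + 2 by rewrite /cs; lia.
rewrite d32 in niso.
have cs2 : 2 <= cs by move: ecs; lia.
clearbody cs es.
have pd : 4 * (cs * es) <= d ^ 2 by rewrite -cses esE; nia.
have [mu [mu0 mu1 gap]] := @gap_exists R d 1 2 (cs * es) d3 isT isT ltac:(by rewrite muln_gt0; lia) pd.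
have leH : (lambda2 R H <= d%:R - mu)%R.
  case: isH => [_ _ /orP[/eqP|/eqP]|C _ _ ocs|C _ _ _ _ CU|ed]; try lia.
  have dcs : d - cs = es by lia.
  rewrite dcs in CU.
  apply: (@lambda2_five_le _ _ _ _ _ d cs es 1 2) => //.
  - by lia.
  - by lia.
  - by rewrite card_ord; lia.
  - by rewrite card_ord.
  - exact: card_cycle_union CU.
  - by rewrite card_ord; lia.
  - by move=> x; apply: deg_complete_le.
  - by move=> x; rewrite -addnA; apply: deg_compl_matching_le; lia.
  - by move=> x; rewrite -addnA; apply: deg_compl_cycles_le CU.
  - by move=> x; apply: deg_compl_matching_le; lia.
set c := #|nbrs_in v A| in ce c0; set e := #|nbrs_in v B| in oe ce e0.
have cep : c * e <= cs * es by rewrite esE mul_le_mid //; lia.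
have [ceE cardA' compA cardB' compB] :=
  cut_extremal dreg cutAB cardA cardB cep mu0 mu1 gap (le_trans le leH).
have cE : c = cs by have [] := @mul_eq_of_sum c e cs es _ ceE; lia.
have eE : e = es by lia.
have [C CU embC] := embeds_inner2 dreg sB compB cardB' eE.
apply: (niso C CU); apply: (iso_five cutAB compA compB) => //.
- by apply: (embeds_outer1 dreg sA compA cardA'); rewrite -/c; lia.
- exact: (embeds_inner1 dreg sA compA cardA').
- by apply: (embeds_outer2 dreg sB compB cardB'); rewrite -/e; lia.
Qed.

Theorem theorem1p1 (R : realType) (d : nat) (G : sgraph)
    (hd : 3 <= d) (hconn : connected G) (hreg : regular d G) :
  [/\ (* (i) *)
      d = 3 ->
      forall H : sgraph, is_Gdc 3 1 H ->
      (lambda2 R G <= lambda2 R H)%R ->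
      ~ iso G (seqjoin [:: complete 2; compl (matching 2); complete 1;
                           complete 1; compl (matching 2); complete 2]) ->
      2 <= kappa G,
      (* (ii) *)
      4 <= d -> ~~ odd d ->
      forall H : sgraph, is_Gdc d (2 * (d %/ 4)) H ->
      (lambda2 R G <= lambda2 R H)%R ->
      ~ iso G (seqjoin [:: complete (2 * ((d + 2) %/ 4) + 1);
                           compl (matching (2 * (d %/ 4)));
                           complete 1;
                           compl (matching (2 * ((d + 2) %/ 4)));
                           complete (2 * (d %/ 4) + 1)]) ->
      2 <= kappa G,
      (* (iii)(a) *)
      5 <= d -> odd d -> odd ((d - 1) %/ 2) ->
      forall H : sgraph, is_Gdc d ((d - 1) %/ 2) H ->
      (lambda2 R G <= lambda2 R H)%R ->
      (forall C : sgraph, is_cycle_union ((d - 1) %/ 2) C ->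
        ~ iso G (seqjoin [:: compl (matching ((d + 5) %/ 2));
                             compl C;
                             complete 1;
                             compl (matching ((d + 1) %/ 2));
                             complete ((d + 1) %/ 2)])) ->
      2 <= kappa G
    & (* (iii)(b) *)
      5 <= d -> odd d -> ~~ odd ((d - 1) %/ 2) ->
      forall H : sgraph, is_Gdc d ((d - 1) %/ 2) H ->
      (lambda2 R G <= lambda2 R H)%R ->
      (forall C : sgraph, is_cycle_union ((d + 1) %/ 2) C ->
        ~ iso G (seqjoin [:: complete ((d + 3) %/ 2);
                             compl (matching ((d - 1) %/ 2));
                             complete 1;
                             compl C;
                             compl (matching ((d + 3) %/ 2))])) ->
      2 <= kappa G].
Proof.
split.
- by move=> d3; move: hreg; rewrite d3 => reg3 H; apply: cubic_case.
- by move=> d4 evd H; apply: even_case.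
- by move=> d5 od oc H; apply: odd_odd_case.
- by move=> d5 od ec H; apply: odd_even_case.
Qed.
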